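(* Let $(\mathfrak h,[\cdot,\cdot]_{\mathfrak h})$ be a Lie algebra. Put $\bar{\mathcal C}^n(\mathfrak h,\mathfrak h):=\mathrm{Hom}(\wedge^n\mathfrak h,\mathrm{Der}(\mathfrak h))$ and $\bar{\mathcal C}^*(\mathfrak h,\mathfrak h):=\oplus_{n\ge0}\bar{\mathcal C}^n(\mathfrak h,\mathfrak h)$. Then $(\bar{\mathcal C}^*(\mathfrak h,\mathfrak h),[\cdot,\cdot]^c,\partial)$ is a differential graded Lie algebra, where $\partial:\bar{\mathcal C}^n(\mathfrak h,\mathfrak h)\to\bar{\mathcal C}^{n+1}(\mathfrak h,\mathfrak h)$ is given by $$(\partial\alpha)(u_1,\dots,u_{n+1})=\sum_{1\le i<j\le n+1}(-1)^{n+i+j-1}\alpha([u_i,u_j]_{\mathfrak h},u_1,\dots,\hat u_i,\dots,\hat u_j,\dots,u_{n+1}),$$ and $[\cdot,\cdot]^c:\bar{\mathcal C}^n(\mathfrak h,\mathfrak h)\times\bar{\mathcal C}^m(\mathfrak h,\mathfrak h)\to\bar{\mathcal C}^{m+n}(\mathfrak h,\mathfrak h)$ is given by $$\begin{aligned}[\alpha,\beta]^c(u_1,\dots,u_{m+n})=&-\sum_{\sigma\in\mathbb S_{(m,1,n-1)}}(-1)^\sigma\alpha(\beta(u_{\sigma(1)},\dots,u_{\sigma(m)})u_{\sigma(m+1)},u_{\sigma(m+2)},\dots,u_{\sigma(m+n)})\\&+(-1)^{mn}\sum_{\sigma\in\mathbb S_{(n,1,m-1)}}(-1)^\sigma\beta(\alpha(u_{\sigma(1)},\dots,u_{\sigma(n)})u_{\sigma(n+1)},u_{\sigma(n+2)},\dots,u_{\sigma(m+n)})\\&-(-1)^{mn}\sum_{\sigma\in\mathbb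 S_{(n,m)}}(-1)^\sigma[\alpha(u_{\sigma(1)},\dots,u_{\sigma(n)}),\beta(u_{\sigma(n+1)},\dots,u_{\sigma(m+n)})]\end{aligned}$$ for $\alpha\in\mathrm{Hom}(\wedge^n\mathfrak h,\mathrm{Der}(\mathfrak h))$, $\beta\in\mathrm{Hom}(\wedge^m\mathfrak h,\mathrm{Der}(\mathfrak h))$ and $u_1,\dots,u_{m+n}\in\mathfrak h$. Moreover, a linear map $L_\rhd:\mathfrak h\to\mathrm{Der}(\mathfrak h)$ defines a post-Lie algebra structure on the Lie algebra $(\mathfrak h,[\cdot,\cdot]_{\mathfrak h})$ if and only if $L_\rhd$ is a Maurer-Cartan element of the differential graded Lie algebra $(\bar{\mathcal C}^*(\mathfrak h,\mathfrak h),[\cdot,\cdot]^c,\partial)$.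
   Context: Vector spaces are over a field of characteristic zero. $\mathrm{Der}(\mathfrak h)$ is the space of derivations of the Lie algebra $\mathfrak h$, with commutator bracket. $\mathbb S_{(i_1,\dots,i_k)}$ is the set of $(i_1,\dots,i_k)$-shuffles: permutations of $\{1,\dots,i_1+\cdots+i_k\}$ increasing on each consecutive block of sizes $i_1,\dots,i_k$ (empty if some $i_j<0$); $(-1)^\sigma$ is the sign of $\sigma$. $\bar{\mathcal C}^n(\mathfrak h,\mathfrak h)$ has degree $n$. A post-Lie algebra $(\mathfrak g,[\cdot,\cdot]_{\mathfrak g},\rhd)$ is a Lie algebra with a binary product $\rhd:\mathfrak g\otimes\mathfrak g\to\mathfrak g$ such that $x\rhd[y,z]_{\mathfrak g}=[x\rhd y,z]_{\mathfrak g}+[y,x\rhd z]_{\mathfrak g}$ and $[x,y]_{\mathfrak g}\rhd z=a_\rhd(x,y,z)-a_\rhd(y,x,z)$, where $a_\rhd(x,y,z)=x\rhd(y\rhd z)-(x\rhd y)\rhd z$. A linear map $L_\rhd:\mathfrak h\to\mathrm{Der}(\mathfrak h)$ defines a post-Lie algebra structure on $\mathfrak h$ if $x\rhd y:=L_\rhd(x)(y)$ makes $(\mathfrak h,[\cdot,\cdot]_{\mathfrak h},\rhd)$ a post-Lie algebra. A Maurer-Cartan element of a differential graded Lie algebra is a degree $1$ element $\theta$ with $d\theta+\frac12[\theta,\theta]=0$. *)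

(* Defs.v *)
From HB Require Import structures.
From mathcomp Require Import all_boot all_order all_fingroup all_algebra ssrAC.
From mathcomp Require Import boolp functions.

Set Implicit Arguments.
Unset Strict Implicit.
Unset Printing Implicit Defensive.

Import GRing.Theory.
Local Open Scope ring_scope.

HB.mixin Record isLieAlgebra (K : fieldType) V of GRing.Lmodule K V := {
  lie : V -> V -> V;
  lie_linearl : forall y, linear (lie^~ y);
  lie_linearr : forall x, linear (lie x);
  liexx : forall x, lie x x = 0;
  lie_jacobi : forall x y z,
    lie x (lie y z) + lie y (lie z x) + lie z (lie x y) = 0
}.

#[short(type="lieAlgType")]
HB.structure Definition LieAlgebra (K : fieldType) :=
  {V of isLieAlgebra K V & GRing.Lmodule K V}.

Section LieTheory.
Context {K : fieldType} {h : lieAlgType K}.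
Implicit Types x y z : h.

Lemma lieDl x y z : lie (x + y) z = lie x z + lie y z.
Proof. by rewrite -{1}[x]scale1r lie_linearl scale1r. Qed.

Lemma lieDr x y z : lie x (y + z) = lie x y + lie x z.
Proof. by rewrite -{1}[y]scale1r lie_linearr scale1r. Qed.

Lemma lie0l x : lie 0 x = 0.
Proof. by apply: (addrI (lie 0 x)); rewrite -lieDl !addr0. Qed.

Lemma lie0r x : lie x 0 = 0.
Proof. by apply: (addrI (lie x 0)); rewrite -lieDr !addr0. Qed.

Lemma lieNl x y : lie (- x) y = - lie x y.
Proof. by apply/eqP; rewrite -addr_eq0 -lieDl addNr lie0l. Qed.

Lemma lieNr x y : lie x (- y) = - lie x y.
Proof. by apply/eqP; rewrite -addr_eq0 -lieDr addNr lie0r. Qed.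

End LieTheory.

Section Derivations.
Context {K : fieldType} (h : lieAlgType K).

Definition is_derivation (D : h -> h) : Prop :=
  linear D /\ forall x y, D (lie x y) = lie (D x) y + lie x (D y).

Definition derivation : {pred h -> h} := fun D => `[< is_derivation D >].

Fact derivation_submod_closed : submod_closed derivation.
Proof.
split=> [|a D E /asboolP[linD derD] /asboolP[linE derE]]; apply/asboolP.
  by split=> [a x y|x y]; rewrite ?scaler0 ?addr0 // /0%R/= ?lie0l ?lie0r ?addr0.
rewrite addrfctE scalrfctE; split=> [b x y|x y] /=.
  by rewrite linD linE !scalerDr !scalerA [b * a]mulrC addrACA.
by rewrite derD derE lie_linearl lie_linearr scalerDr addrACA.
Qed.

HB.instance Definition _ :=
  GRing.isSubmodClosed.Build K (h -> h) derivation derivation_submod_closed.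

Record Der := MkDer { der_fun :> h -> h; der_funP : der_fun \in derivation }.

HB.instance Definition _ := [isSub for der_fun].
HB.instance Definition _ := [Choice of Der by <:].
HB.instance Definition _ := [SubChoice_isSubLmodule of Der by <:].

Lemma derP (D E : Der) : (forall x, D x = E x) -> D = E.
Proof. by move=> DE; apply/val_inj/funext. Qed.

Lemma der_linear (D : Der) : linear D.
Proof. by have /asboolP[] := der_funP D. Qed.

Lemma der_lie (D : Der) x y : D (lie x y) = lie (D x) y + lie x (D y).
Proof. by have /asboolP[_] := der_funP D. Qed.

Lemma derD (D : Der) x y : D (x + y) = D x + D y.
Proof. by rewrite -{1}[x]scale1r der_linear scale1r. Qed.

Lemma derN (D : Der) x : D (- x) = - D x.
Proof.
have D0 : D 0 = 0 by apply: (addrI (D 0)); rewrite -derD !addr0.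
by apply/eqP; rewrite -addr_eq0 -derD addNr D0.
Qed.

Fact der_comm_subproof (D E : Der) :
  (fun x => D (E x) - E (D x)) \in derivation.
Proof.
apply/asboolP; split=> [a x y|x y].
  by rewrite !der_linear scalerBr opprD addrACA.
rewrite !der_lie !derD !der_lie lieDl lieDr lieNl lieNr.
rewrite [X in X - _ = _](AC (2*2) (1*4*(2*3)))
  [X in _ - X = _](AC (2*2) (3*2*(1*4))) /=.
by rewrite addrKA opprD addrACA.
Qed.

Definition der_comm (D E : Der) : Der := MkDer (der_comm_subproof D E).

Fact der_comm_linearl E : linear (der_comm^~ E).
Proof.
move=> a D F; apply: derP => x /=.
by rewrite /= der_linear scalerBr opprD addrACA.
Qed.

Fact der_comm_linearr D : linear (der_comm D).
Proof.
move=> a E F; apply: derP => x /=.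
by rewrite /= der_linear scalerBr opprD addrACA.
Qed.

Fact der_commxx D : der_comm D D = 0.
Proof. by apply: derP => x /=; rewrite subrr. Qed.

Fact der_comm_jacobi D E F :
  der_comm D (der_comm E F) + der_comm E (der_comm F D)
    + der_comm F (der_comm D E) = 0.
Proof.
apply: derP => x.
have addE (F1 F2 : Der) : (F1 + F2) x = F1 x + F2 x by [].
rewrite !addE /= !derD !derN !opprB !addrA.
rewrite [LHS](ACl ((1*12)*(7*2)*(3*10)*(5*4)*(11*6)*(9*8))) /=.
by rewrite !subrr !addr0.
Qed.

HB.instance Definition _ := isLieAlgebra.Build K Der
  der_comm_linearl der_comm_linearr der_commxx der_comm_jacobi.

End Derivations.

Section Cochains.
Context {K : fieldType} (h : lieAlgType K) (n : nat).

Definition multilinear (W : lmodType K) (f : ('I_n -> h) -> W) : Prop :=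
  forall (u : 'I_n -> h) (i : 'I_n), linear (fun x : h => f [eta u with i |-> x]).

Definition alternating (W : lmodType K) (f : ('I_n -> h) -> W) : Prop :=
  forall (u : 'I_n -> h) (i j : 'I_n), i != j -> u i = u j -> f u = 0.

(* Hom(/\^n h, Der h), through the universal property of the exterior power. *)
Definition cochain : {pred ('I_n -> h) -> Der h} :=
  fun f => `[< multilinear f /\ alternating f >].

Fact cochain_submod_closed : submod_closed cochain.
Proof.
split=> [|a f g /asboolP[linf altf] /asboolP[ling altg]]; apply/asboolP.
  by split=> [u i a x y|u i j _ _]; rewrite ?scaler0 ?addr0.
rewrite addrfctE scalrfctE; split=> [u i b x y|u i j ij uij] /=.
  by rewrite linf ling !scalerDr !scalerA [b * a]mulrC addrACA.
by rewrite (altf u i j) // (altg u i j) // scaler0 addr0.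
Qed.

HB.instance Definition _ :=
  GRing.isSubmodClosed.Build K (('I_n -> h) -> Der h) cochain
    cochain_submod_closed.

Record Cbar := MkCbar {
  Cbar_fun :> ('I_n -> h) -> Der h;
  Cbar_funP : Cbar_fun \in cochain
}.

HB.instance Definition _ := [isSub for Cbar_fun].
HB.instance Definition _ := [Choice of Cbar by <:].
HB.instance Definition _ := [SubChoice_isSubLmodule of Cbar by <:].

End Cochains.

Section LinearAsCochain.
Context {K : fieldType} {h : lieAlgType K} (L : {linear h -> Der h}).

Fact Cbar1_subproof : (fun u : 'I_1 -> h => L (u ord0)) \in @cochain K h 1.
Proof.
apply/asboolP; split=> [u i a x y|u i j]; last by rewrite !ord1.
by rewrite /= !ord1 eqxx linearP.
Qed.

Definition Cbar1 : Cbar h 1 := MkCbar Cbar1_subproof.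

End LinearAsCochain.

(* (i_1, ..., i_k)-shuffles of N = i_1 + ... + i_k letters. The sizes are      *)
(* integers so that sizes such as n - 1 with n = 0 give the empty set.         *)
(* [reshape_index] is the index of the block containing a given position.      *)
Definition shuffles (N : nat) (s : seq int) : {set 'S_N} :=
  [set sigma : 'S_N | all (fun i => 0 <= i) s &
    [forall p : 'I_N, forall q : 'I_N,
      [&& reshape_index (map absz s) p == reshape_index (map absz s) q
        & (p < q)%N] ==> (sigma p < sigma q)%N]].

Section Operations.
Context {K : fieldType} {h : lieAlgType K}.

(* Indices start at 0, so the sign (-1)^(n + i + j - 1) of 1-based indices     *)
(* becomes (-1)^(n + i + j + 1). [bump j (bump i k)] is the k-th index         *)
(* different from i and j when i < j.                                          *)
Definition Cbar_diff_formula n (alpha : Cbar h n) (u : 'I_n.+1 -> h) : Der h :=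
  \sum_(i < n.+1) \sum_(j < n.+1 | (i < j)%N)
    (-1) ^+ (n + i + j + 1) *:
      alpha (fun k : 'I_n =>
        if k == 0%N :> nat then lie (u i) (u j)
        else u (inord (bump j (bump i k.-1)))).

(* sum over sigma in S_(m, 1, n - 1) of (-1)^sigma                             *)
(*   alpha (beta (u_sigma(1), ..., u_sigma(m)) u_sigma(m+1),                   *)
(*          u_sigma(m+2), ..., u_sigma(m+n))                                   *)
Definition insertion_sum n m (alpha : Cbar h n) (beta : Cbar h m)
    (u : 'I_(m + n) -> h) : Der h :=
  \sum_(sigma in shuffles (m + n) [:: m%:Z; 1; n%:Z - 1])
    (-1) ^+ sigma *:
      alpha (fun k : 'I_n =>
        let v := u (sigma (rshift m k)) in
        if k == 0%N :> nat
        then beta (fun l : 'I_m => u (sigma (lshift n l))) v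
        else v).

(* [cast_ord] only identifies 'I_(m + n) with 'I_(n + m). *)
Definition Cbar_bracket_formula n m (alpha : Cbar h n) (beta : Cbar h m)
    (u : 'I_(n + m) -> h) : Der h :=
  - insertion_sum alpha beta (u \o cast_ord (addnC m n))
  + (-1) ^+ (m * n) *: insertion_sum beta alpha u
  - (-1) ^+ (m * n) *:
      \sum_(sigma in shuffles (n + m) [:: n%:Z; m%:Z])
        (-1) ^+ sigma *:
          lie (alpha (fun k : 'I_n => u (sigma (lshift m k))))
              (beta (fun l : 'I_m => u (sigma (rshift n l)))).

End Operations.

Definition degcast (K : fieldType) (V : nat -> lmodType K) m n (e : m = n)
    (x : V m) : V n :=
  ecast i (V i) e x.
Arguments degcast {K} V {m n} e x.

(* A graded vector space is given by its homogeneous components; the           *)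
(* components of negative degree are zero and omitted.                         *)
Record isDGLieAlgebra (K : fieldType) (V : nat -> lmodType K)
    (br : forall n m, V n -> V m -> V (n + m)%N)
    (d : forall n, V n -> V n.+1) : Prop := {
  dg_br_linearl : forall n m (y : V m), linear (fun x : V n => br n m x y);
  dg_br_linearr : forall n m (x : V n), linear (br n m x);
  dg_d_linear : forall n, linear (d n);
  dg_antisym : forall n m (x : V n) (y : V m),
    br n m x y = - (-1) ^+ (n * m) *: degcast V (addnC m n) (br m n y x);
  dg_jacobi : forall n m p (x : V n) (y : V m) (z : V p),
    br n (m + p)%N x (br m p y z) =
      degcast V (esym (addnA n m p)) (br (n + m)%N p (br n m x y) z)
      + (-1) ^+ (n * m) *:
          degcast V (addnCA m n p) (br m (n + p)%N y (br n p x z));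
  dg_d_square : forall n (x : V n), d n.+1 (d n x) = 0;
  dg_leibniz : forall n m (x : V n) (y : V m),
    d (n + m)%N (br n m x y) =
      br n.+1 m (d n x) y
      + (-1) ^+ n *: degcast V (addnS n m) (br n m.+1 x (d m y))
}.

Definition isMaurerCartan (K : fieldType) (V : nat -> lmodType K)
    (br : forall n m, V n -> V m -> V (n + m)%N)
    (d : forall n, V n -> V n.+1) (theta : V 1%N) : Prop :=
  d 1%N theta + 2^-1 *: br 1%N 1%N theta theta = 0.

Definition associator (V : zmodType) (rhd : V -> V -> V) (x y z : V) : V :=
  rhd x (rhd y z) - rhd (rhd x y) z.

Record isPostLie (K : fieldType) (g : lieAlgType K) (rhd : g -> g -> g) :
    Prop := {
  postlie_linearl : forall y, linear (rhd^~ y);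
  postlie_linearr : forall x, linear (rhd x);
  postlie_der : forall x y z,
    rhd x (lie y z) = lie (rhd x y) z + lie y (rhd x z);
  postlie_assoc : forall x y z,
    rhd (lie x y) z = associator rhd x y z - associator rhd y x z
}.

(* Main.v *)
Require Import Defs.
From mathcomp Require Import all_boot all_order all_fingroup all_algebra.
From mathcomp Require Import boolp functions zify.

Import GRing.Theory.
Local Open Scope ring_scope.

Set Implicit Arguments.
Unset Strict Implicit.
Unset Printing Implicit Defensive.

(** The theorem is the action Lie algebroid construction over the graded
    manifold h[1], whose functions are the alternating forms on h.  The Lie
    algebra Der(h) acts on h[1] by linear vector fields, so a cochain alpha
    (a Der(h)-valued form) determines the vector field X_alpha whose value at
    the point x is alpha(x, .., x) x; here it is [hat alpha], and it acts on
    forms by insertion, [ins (hat alpha)].  Up to the global sign (-1)^(mn) the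
    bracket of the statement is the algebroid bracket
      X_alpha beta - (-1)^(mn) X_beta alpha - [alpha /\ beta],
    and the differential is, up to the sign (-1)^n, insertion of the
    Chevalley-Eilenberg vector field [mu], the Lie bracket of h.

    Four facts carry the proof.  Insertion of a vector field is a graded
    derivation of the wedge product ([ins_wedge]).  The graded commutator of two
    insertions is the insertion of the commutator of the vector fields
    ([ins_comm]).  A Jacobi-like identity between bilinear maps passes to wedge
    products of forms ([wedge_jacobi]).  Hence alpha |-> X_alpha turns the
    bracket into the commutator of vector fields ([ins_hat_wbracket]), and the
    graded Jacobi identity is a formal consequence.  Finally a derivation of h
    is a symmetry of [mu] ([ins_mu_hat]), which makes the differential a
    derivation of the bracket, and the Jacobi identity of h makes its square
    vanish ([wdiff_square]).

    Forms are represented by functions on words in h.  A shuffle sum on a word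
    is then defined by recursion, its first letter going to one block or to the
    other, and contraction with a vector (prefixing a letter) satisfies a
    Leibniz rule for insertions and for wedge products.  Applying this rule
    turns each identity into the same identity for contracted forms on a
    shorter word, whence short inductions in which only the parities of the
    degrees matter.  The sums over shuffle permutations obey the same recursion,
    because in a shuffle the value 0 is attained at the first position of a
    block ([sum_block_shuffles]).

    The Maurer-Cartan equation of a linear map L, evaluated at x and y, reads
      [L x, L y] - L (L x y) + L (L y x) - L [x, y] = 0,
    and applied to z this is the associator identity of a post-Lie algebra; the
    other axioms hold because L takes values in derivations. *)

(** * Linear arithmetic in abelian groups *)

(** A decision procedure for equations in an abelian group: both sides are
    reified over a common list of atoms and compared by their coefficients. *)
Inductive zexpr := ZAtom of nat | ZAdd of zexpr & zexpr | ZOpp of zexpr | ZZero.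

Fixpoint zcoef (e : zexpr) (i : nat) : int :=
  match e with
  | ZAtom j => (i == j : nat)%:Z
  | ZAdd e1 e2 => zcoef e1 i + zcoef e2 i
  | ZOpp e1 => - zcoef e1 i
  | ZZero => 0
  end.

Section ZEval.
Context {V : zmodType} (env : seq V).

Fixpoint zeval (e : zexpr) : V :=
  match e with
  | ZAtom j => env`_j
  | ZAdd e1 e2 => zeval e1 + zeval e2
  | ZOpp e1 => - zeval e1
  | ZZero => 0
  end.

Lemma zevalE e : zeval e = \sum_(i < size env) env`_i *~ zcoef e i.
Proof.
elim: e => [j|e1 IH1 e2 IH2|e1 IH1|] /=.
- have [j_in|j_out] := ltnP j (size env).
    rewrite (bigD1 (Ordinal j_in)) //= eqxx mulr1z big1 ?addr0 // => i.
    by rewrite -val_eqE /= => /negbTE->; rewrite mulr0z.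
  rewrite nth_default // big1 // => i _.
  by rewrite ltn_eqF ?mulr0z // (leq_trans (ltn_ord i)).
- by rewrite IH1 IH2 -big_split; apply: eq_bigr => i _; rewrite mulrzDr.
- by rewrite IH1 -sumrN; apply: eq_bigr => i _; rewrite mulrNz.
- by rewrite big1 // => i _; rewrite mulr0z.
Qed.

Lemma zeval_eq e1 e2 :
  all (fun i => zcoef e1 i == zcoef e2 i) (iota 0 (size env)) ->
  zeval e1 = zeval e2.
Proof.
move=> /allP eq12; rewrite !zevalE; apply: eq_bigr => i _.
by rewrite (eqP (eq12 i _)) // mem_iota /=.
Qed.

End ZEval.

(** Atoms are identified up to unification rather than syntactically, since
    the same element often occurs with different paths through the algebraic
    hierarchy. *)
Ltac zmod_index x env :=
  lazymatch env with
  | ?y :: ?env' =>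
    match constr:(Set) with
    | _ => let _ := match constr:(Set) with _ => unify x y end in
           constr:(0%N)
    | _ => let i := zmod_index x env' in constr:(S i)
    end
  end.

Ltac zmod_mem x env :=
  lazymatch env with
  | [::] => constr:(false)
  | ?y :: ?env' =>
    match constr:(Set) with
    | _ => let _ := match constr:(Set) with _ => unify x y end in
           constr:(true)
    | _ => zmod_mem x env'
    end
  end.

Ltac zmod_atoms t env :=
  lazymatch t with
  | (?t1 + ?t2)%R => let env1 := zmod_atoms t1 env in zmod_atoms t2 env1
  | (- ?t1)%R => zmod_atoms t1 env
  | 0%R => env
  | _ => lazymatch zmod_mem t env with
         | true => env
         | false => constr:(t :: env)
         end
  end.

Ltac zmod_reify t env :=
  lazymatch t with
  | (?t1 + ?t2)%R => let e1 := zmod_reify t1 env in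
      let e2 := zmod_reify t2 env in constr:(ZAdd e1 e2)
  | (- ?t1)%R => let e1 := zmod_reify t1 env in constr:(ZOpp e1)
  | 0%R => constr:(ZZero)
  | _ => let i := zmod_index t env in constr:(ZAtom i)
  end.

Ltac zmod :=
  lazymatch goal with
  | |- @eq ?V ?x ?y =>
    let env := zmod_atoms x (@nil V) in
    let env := zmod_atoms y env in
    let e1 := zmod_reify x env in
    let e2 := zmod_reify y env in
    refine (@zeval_eq _ env e1 e2 _); vm_compute; reflexivity
  end.

(** * Shuffle sums and alternating forms on words *)

Section ShuffleSum.
Context {K : fieldType} {h : lmodType K}.
Implicit Types (W : lmodType K) (s t S T : seq h).

(** The sum over all splittings of the word [s] into two complementary subwords
    [S] and [T] of [(-1)^sigma *: B S T], where sigma is the corresponding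
    shuffle: a letter that goes to [T] jumps over the later letters of [S], and
    these are exactly the letters counted by [size S] in the recursive call. *)
Fixpoint shsum W (B : seq h -> seq h -> W) s : W :=
  if s is u :: s' then
    shsum (fun S T => B (u :: S) T) s'
    + shsum (fun S T => (-1) ^+ size S *: B S (u :: T)) s'
  else B [::] [::].

Lemma eq_shsum W (B B' : seq h -> seq h -> W) s :
  (forall S T, (size S + size T)%N = size s -> B S T = B' S T) ->
  shsum B s = shsum B' s.
Proof.
elim: s B B' => [|u s IHs] B B' eqB /=; first exact: eqB.
congr (_ + _); apply: IHs => S T sST; rewrite eqB //= ?addSn ?addnS sST //.
Qed.

Lemma shsumP W (a : K) (B B' : seq h -> seq h -> W) s :
  shsum (fun S T => a *: B S T + B' S T) s = a *: shsum B s + shsum B' s.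
Proof.
elim: s B B' => //= u s IHs B B'; rewrite IHs scalerDr -!addrA; congr (_ + _).
rewrite addrCA; congr (_ + _); rewrite -IHs; apply: eq_shsum => S T _.
by rewrite scalerDr !scalerA mulrC.
Qed.

Lemma linear_shsum W W' (f : W -> W') (B : seq h -> seq h -> W) s :
  linear f -> f (shsum B s) = shsum (fun S T => f (B S T)) s.
Proof.
move=> linf; have fD x y : f (x + y) = f x + f y.
  by rewrite -{1}[x]scale1r linf scale1r.
have f0 : f 0 = 0 by apply: (addrI (f 0)); rewrite -fD !addr0.
elim: s B => //= u s IHs B; rewrite fD !IHs; congr (_ + _).
by apply: eq_shsum => S T _; rewrite -[X in f X]addr0 linf f0 addr0.
Qed.

Lemma shsum0 W s : shsum (fun _ _ => 0 : W) s = 0.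
Proof.
elim: s => //= u s IHs; rewrite IHs add0r -[RHS]IHs.
by apply: eq_shsum => S T _; rewrite scaler0.
Qed.

Lemma shsum_eq0 W (B : seq h -> seq h -> W) s :
  (forall S T, (size S + size T)%N = size s -> B S T = 0) -> shsum B s = 0.
Proof. by move=> B0; rewrite -[RHS](shsum0 W s); apply: eq_shsum. Qed.

Lemma shsumD W (B B' : seq h -> seq h -> W) s :
  shsum (fun S T => B S T + B' S T) s = shsum B s + shsum B' s.
Proof.
by rewrite -[shsum B s]scale1r -shsumP; apply: eq_shsum => S T _;
  rewrite scale1r.
Qed.

Lemma shsumZ W a (B : seq h -> seq h -> W) s :
  shsum (fun S T => a *: B S T) s = a *: shsum B s.
Proof.
rewrite -[RHS]addr0 -[0 in RHS](shsum0 W s) -shsumP; apply: eq_shsum => S T _.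
by rewrite addr0.
Qed.

Lemma shsumN W (B : seq h -> seq h -> W) s :
  shsum (fun S T => - B S T) s = - shsum B s.
Proof.
by rewrite -scaleN1r -shsumZ; apply: eq_shsum => S T _; rewrite scaleN1r.
Qed.

(** Alternating multilinear forms, not necessarily homogeneous, whose
    homogeneous components all have degree of parity [a].  Keeping only the
    parity makes sense of contracting a form of degree 0, and the parity
    determines all the signs. *)
Record aform W (a : bool) (f : seq h -> W) : Prop := Form {
  aform_linear : forall s t, linear (fun x => f (s ++ x :: t));
  aform_skew : forall s t x y, f (s ++ x :: y :: t) = - f (s ++ y :: x :: t);
  aform_parity : forall s, odd (size s) != a -> f s = 0
}.

(** The interior product with [u]. *)
Definition contract W (u : h) (f : seq h -> W) : seq h -> W :=
  fun s => f (u :: s).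

Section Form.
Context {W : lmodType K} {a : bool} {f : seq h -> W} (ff : aform a f).

Lemma aformD s t x y :
  f (s ++ (x + y) :: t) = f (s ++ x :: t) + f (s ++ y :: t).
Proof. by rewrite -{1}[x]scale1r (aform_linear ff) scale1r. Qed.

Lemma aform0 s t : f (s ++ 0 :: t) = 0.
Proof. by apply: (addrI (f (s ++ 0 :: t))); rewrite -aformD !addr0. Qed.

Lemma aformZ s t c x : f (s ++ (c *: x) :: t) = c *: f (s ++ x :: t).
Proof. by rewrite -[c *: x]addr0 (aform_linear ff) aform0 addr0. Qed.

Lemma aform_sign s : (-1) ^+ size s *: f s = (-1) ^+ a *: f s.
Proof.
rewrite -signr_odd; have [->//|/eqP neq] := eqVneq (odd (size s)) a.
by rewrite (aform_parity ff) ?scaler0 //; apply/eqP.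
Qed.

Lemma aform_contract u : aform (~~ a) (contract u f).
Proof.
split=> [s t|s t x y|s]; rewrite /contract.
- exact: (aform_linear ff (u :: s)).
- exact: (aform_skew ff (u :: s)).
- by move=> par; rewrite (aform_parity ff) //=; apply: contra par => /eqP<-;
    rewrite negbK.
Qed.
End Form.

Lemma aform_lincomb W a c (f g : seq h -> W) : aform a f -> aform a g ->
  aform a (fun s => c *: f s + g s).
Proof.
move=> ff fg; split=> [s t e x y|s t x y|s par].
- rewrite /= (aform_linear ff) (aform_linear fg)
  !scalerDr !scalerA [c * e]mulrC.
  zmod.
- by rewrite (aform_skew ff) (aform_skew fg) scalerN opprD.
- by rewrite (aform_parity ff) // (aform_parity fg) // scaler0 addr0.
Qed.

Lemma aform_zero W a : aform a (fun=> 0 : W).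
Proof. by split=> [s t c x y|s t x y|s _]; rewrite ?scaler0 ?addr0 ?oppr0. Qed.

Lemma aform_scale W a c (f : seq h -> W) :
  aform a f -> aform a (fun s => c *: f s).
Proof.
move=> ff; have := aform_lincomb c ff (aform_zero W a).
by congr aform; apply/funext=> s; rewrite addr0.
Qed.

Lemma aform_add W a (f g : seq h -> W) : aform a f -> aform a g ->
  aform a (fun s => f s + g s).
Proof.
move=> ff fg; have := aform_lincomb 1 ff fg.
by congr aform; apply/funext=> s; rewrite scale1r.
Qed.

Lemma aform_opp W a (f : seq h -> W) : aform a f -> aform a (fun s => - f s).
Proof.
move=> /(aform_scale (-1)); by congr aform; apply/funext=> s; rewrite scaleN1r.
Qed.

Lemma shsum_linear W (B : seq h -> seq h -> W) s t :
  (forall T s t, linear (fun x => B (s ++ x :: t) T)) ->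
  (forall S s t, linear (fun x => B S (s ++ x :: t))) ->
  linear (fun x => shsum B (s ++ x :: t)).
Proof.
elim: s B => [|u s IHs] B linl linr /=.
  move=> c x y; rewrite [c *: (_ + _)]scalerDr addrACA -!shsumP; congr (_ + _).
    by apply: eq_shsum => S T _; rewrite (linl T [::] S).
  apply: eq_shsum => S T _; rewrite (linr S [::] T).
  by rewrite scalerDr !scalerA mulrC.
move=> c x y; rewrite !IHs; first by rewrite scalerDr addrACA.
- by move=> T s' t' e x' y'; rewrite linl // !size_cat /= scalerDr !scalerA
  mulrC.
- by move=> S s' t' e x' y'; rewrite (linr S (u :: s')) scalerDr !scalerA mulrC.
- by move=> T s' t'; apply: (linl T (u :: s')).
- by move=> S s' t'; apply: linr.
Qed.

Lemma shsum_skew W (B : seq h -> seq h -> W) s t x y :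
  (forall T s t x y, B (s ++ x :: y :: t) T = - B (s ++ y :: x :: t) T) ->
  (forall S s t x y, B S (s ++ x :: y :: t) = - B S (s ++ y :: x :: t)) ->
  shsum B (s ++ x :: y :: t) = - shsum B (s ++ y :: x :: t).
Proof.
elim: s B => [|u s IHs] B skewl skewr /=.
  rewrite -!shsumD -shsumN; apply: eq_shsum => S T _ /=.
  rewrite (skewl T [::] S) (skewr S [::] T) /= !exprS !mulN1r !scaleNr !scalerN.
  zmod.
rewrite !IHs ?opprD // => [T s' t' x' y'|S s' t' x' y'|T s' t' x' y'].
- by rewrite skewl !size_cat /= scalerN.
- by rewrite (skewr S (u :: s')) scalerN.
- by rewrite (skewl T (u :: s')).
Qed.

Definition bilin W1 W2 W3 (phi : W1 -> W2 -> W3) :=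
  (forall y, linear (phi^~ y)) /\ (forall x, linear (phi x)).

Section Bilin.
Context {W1 W2 W3 : lmodType K} {phi : W1 -> W2 -> W3} (bphi : bilin phi).

Lemma bilinDl x x' y : phi (x + x') y = phi x y + phi x' y.
Proof. by rewrite -{1}[x]scale1r bphi.1 scale1r. Qed.
Lemma bilinDr x y y' : phi x (y + y') = phi x y + phi x y'.
Proof. by rewrite -{1}[y]scale1r bphi.2 scale1r. Qed.
Lemma bilin0l y : phi 0 y = 0.
Proof. by apply: (addrI (phi 0 y)); rewrite -bilinDl !addr0. Qed.
Lemma bilin0r x : phi x 0 = 0.
Proof. by apply: (addrI (phi x 0)); rewrite -bilinDr !addr0. Qed.
Lemma bilinZl c x y : phi (c *: x) y = c *: phi x y.
Proof. by rewrite -[c *: x]addr0 bphi.1 bilin0l addr0. Qed.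
Lemma bilinZr c x y : phi x (c *: y) = c *: phi x y.
Proof. by rewrite -[c *: y]addr0 bphi.2 bilin0r addr0. Qed.
Lemma bilinNl x y : phi (- x) y = - phi x y.
Proof. by rewrite -scaleN1r bilinZl scaleN1r. Qed.
Lemma bilinNr x y : phi x (- y) = - phi x y.
Proof. by rewrite -scaleN1r bilinZr scaleN1r. Qed.
End Bilin.

Definition wedge W1 W2 W3 (phi : W1 -> W2 -> W3) (f : seq h -> W1)
    (g : seq h -> W2) : seq h -> W3 :=
  shsum (fun S T => phi (f S) (g T)).

(** The action on [f] of the vector field [P] on h[1]: the value of [P] at one
    block of arguments is inserted in the first slot of [f]. *)
Definition ins W (P : seq h -> h) (f : seq h -> W) : seq h -> W :=
  shsum (fun S T => f (P S :: T)).

Lemma aform_wedge W1 W2 W3 (phi : W1 -> W2 -> W3) a b f g : bilin phi ->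
  aform a f -> aform b g -> aform (a (+) b) (wedge phi f g).
Proof.
move=> bphi ff fg; split=> [s t|s t x y|s par].
- apply: shsum_linear => [T|S] s' t' c x y.
    by rewrite (aform_linear ff) bphi.1.
  by rewrite (aform_linear fg) bphi.2.
- apply: shsum_skew => [T|S] s' t' x' y'.
    by rewrite (aform_skew ff) (bilinNl bphi).
  by rewrite (aform_skew fg) (bilinNr bphi).
- apply: shsum_eq0 => S T sST; move: par; rewrite -sST oddD => par.
  have [eS|/(aform_parity ff)->] := eqVneq (odd (size S)) a; last first.
    exact: bilin0l.
  rewrite (aform_parity fg) ?(bilin0r bphi) //.
  by apply: contra par => /eqP->; rewrite eS.
Qed.

(** A vector field of degree [d] is an h-valued form of degree [d + 1], hence
    the parity [~~ d] of [P] here and below. *)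
Lemma aform_ins W d a P (f : seq h -> W) :
  aform (~~ d) P -> aform a f -> aform (d (+) a) (ins P f).
Proof.
move=> fP ff; split=> [s t|s t x y|s par].
- apply: shsum_linear => [T|S] s' t' c x y.
    by rewrite (aform_linear fP) (aform_linear ff [::]).
  by rewrite (aform_linear ff (P S :: s')).
- apply: shsum_skew => [T|S] s' t' x' y'.
    by rewrite (aform_skew fP) -scaleN1r (aformZ ff [::]) scaleN1r.
  by rewrite (aform_skew ff (P S :: s')).
- apply: shsum_eq0 => S T sST; move: par; rewrite -sST oddD => par.
  have [eS|/(aform_parity fP)->] := eqVneq (odd (size S)) (~~ d); last first.
    exact: (aform0 ff [::]).
  apply: (aform_parity ff); apply: contra par => /= /eqP <-.
  by rewrite eS; case: (d); case: odd.
Qed.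

(** The first letter goes either into [P] or into [f]; in the second case it
    has to be moved in front of the value of [P], which costs the sign of the
    degree of the vector field. *)
Lemma contract_ins W d a P (f : seq h -> W) u s :
  aform (~~ d) P -> aform a f ->
  ins P f (u :: s) =
    ins (contract u P) f s + (-1) ^+ d *: ins P (contract u f) s.
Proof.
move=> fP ff; rewrite /ins /= -shsumZ; congr (_ + _); apply: eq_shsum => S T _.
rewrite (aform_skew ff [::]) /contract scalerN -(aformZ ff [:: u])
  (aform_sign fP).
by rewrite (aformZ ff [:: u]) /= -scaleNr; case: (d); rewrite /= ?opprK.
Qed.

(** The interior product is a graded derivation of the wedge product. *)
Lemma contract_wedge W1 W2 W3 (phi : W1 -> W2 -> W3) a b f g u s : bilin phi ->
  aform a f -> aform b g ->
  wedge phi f g (u :: s) =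
    wedge phi (contract u f) g s + (-1) ^+ a *: wedge phi f (contract u g) s.
Proof.
move=> bphi ff fg; rewrite /wedge /= -shsumZ; congr (_ + _).
by apply: eq_shsum => S T _; rewrite -!(bilinZl bphi) (aform_sign ff).
Qed.

End ShuffleSum.

(** * Calculus of wedge products and insertions *)

Ltac signs := rewrite /= ?expr0 ?expr1 ?scale1r ?scaleN1r.

Section Operators.
Context {K : fieldType} {h : lmodType K}.
Implicit Types (W : lmodType K) (s t S T : seq h).

Lemma ins_lincomb W P c (f g : seq h -> W) s :
  ins P (fun s => c *: f s + g s) s = c *: ins P f s + ins P g s.
Proof. exact: shsumP. Qed.

Lemma ins_lincomb_field W a c P Q (f : seq h -> W) s : aform a f ->
  ins (fun s => c *: P s + Q s) f s = c *: ins P f s + ins Q f s.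
Proof.
move=> ff; rewrite /ins -shsumP; apply: eq_shsum => S T _.
exact: (aform_linear ff [::]).
Qed.

Section Wedge.
Context {W1 W2 W3 : lmodType K} {phi : W1 -> W2 -> W3} (bphi : bilin phi).

Lemma wedge_lincombl c f f' g s :
  wedge phi (fun s => c *: f s + f' s) g s =
    c *: wedge phi f g s + wedge phi f' g s.
Proof. by rewrite /wedge -shsumP; apply: eq_shsum => S T _; rewrite bphi.1. Qed.

Lemma wedge_lincombr c f g g' s :
  wedge phi f (fun s => c *: g s + g' s) s =
    c *: wedge phi f g s + wedge phi f g' s.
Proof. by rewrite /wedge -shsumP; apply: eq_shsum => S T _; rewrite bphi.2. Qed.

End Wedge.

Lemma contract_wedge_fun W1 W2 W3 (phi : W1 -> W2 -> W3) a b f g u :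
  bilin phi -> aform a f -> aform b g ->
  contract u (wedge phi f g) = fun s =>
    (-1) ^+ a *: wedge phi f (contract u g) s + wedge phi (contract u f) g s.
Proof.
by move=> bphi ff fg; apply/funext => s; rewrite addrC;
  apply: contract_wedge fg.
Qed.

Lemma contract_ins_fun W d a P (f : seq h -> W) u :
  aform (~~ d) P -> aform a f ->
  contract u (ins P f) =
    fun s => (-1) ^+ d *: ins P (contract u f) s + ins (contract u P) f s.
Proof.
by move=> fP ff; apply/funext => s; rewrite addrC; apply: contract_ins ff.
Qed.

(** By induction on the word: contracting with a letter gives three instances
    of the identity, with [P], [f] or [g] replaced by its contraction. *)
Lemma ins_wedge W1 W2 W3 (phi : W1 -> W2 -> W3) d a b P f g s : bilin phi ->
  aform (~~ d) P -> aform a f -> aform b g ->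
  ins P (wedge phi f g) s =
    wedge phi (ins P f) g s + (-1) ^+ (d && a) *: wedge phi f (ins P g) s.
Proof.
move=> bphi; elim: s d a b P f g => [|u s IHs] d a b P f g fP ff fg.
  rewrite /wedge /ins /= expr0 scale1r; congr (_ + _).
  case: a ff => ff; last by rewrite andbF scale1r.
  by rewrite (aform_parity ff) // (bilin0l bphi) scaler0.
have fuP := aform_contract fP u; have fuf := aform_contract ff u.
have fug := aform_contract fg u.
rewrite (contract_ins _ _ fP (aform_wedge bphi ff fg)).
rewrite (contract_wedge_fun _ bphi ff fg) ins_lincomb.
rewrite (contract_wedge _ _ bphi (aform_ins fP ff) fg).
rewrite (contract_wedge _ _ bphi ff (aform_ins fP fg)).
rewrite (contract_ins_fun _ fP ff) (contract_ins_fun _ fP fg).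
rewrite (wedge_lincombl bphi) (wedge_lincombr bphi).
rewrite (IHs _ _ _ _ _ _ fuP ff fg) (IHs _ _ _ _ _ _ fP fuf fg).
rewrite (IHs _ _ _ _ _ _ fP ff fug) !scalerDr !scalerA -!signr_addb.
by case: (d); case: (a); signs; zmod.
Qed.

Lemma aform_ins_field d e (P Q : seq h -> h) :
  aform (~~ d) P -> aform (~~ e) Q ->
  aform (~~ (d (+) e)) (ins P Q).
Proof. by move=> fP fQ; have := aform_ins fP fQ; rewrite addbN. Qed.

(** The commutator of vector fields on h[1]: the second order terms of the
    two compositions cancel.  Again contraction turns the identity into its
    instances for the contractions of [P], [Q] and [f]; on the empty word what
    remains is the skew-symmetry of [f]. *)
Lemma ins_comm W d e a P Q (f : seq h -> W) s :
  aform (~~ d) P -> aform (~~ e) Q -> aform a f ->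
  ins P (ins Q f) s =
    (-1) ^+ (d && e) *: ins Q (ins P f) s + ins (ins P Q) f s
    - (-1) ^+ (d && e) *: ins (ins Q P) f s.
Proof.
elim: s d e a P Q f => [|u s IHs] d e a P Q f fP fQ ff.
  have Q0 : ~~ e -> Q [::] = 0 by case: (e) fQ => // fQ _;
    apply: (aform_parity fQ).
  have P0 : ~~ d -> P [::] = 0 by case: (d) fP => // fP _;
    apply: (aform_parity fP).
  have /= skew := aform_skew ff [::] [::] (P [::]) (Q [::]).
  have f0l t : f (0 :: t) = 0 := aform0 ff [::] t.
  have f0r x t : f (x :: 0 :: t) = 0 := aform0 ff [:: x] t.
  rewrite /ins /= expr0 !scale1r skew !scalerDr !scalerN.
  case: d {fP} P0 => [_|/(_ isT)->].
    case: e {fQ} Q0 => [_|/(_ isT)->]; first by signs; zmod.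
    by rewrite !(f0l, f0r); signs; zmod.
  by rewrite !(f0l, f0r); signs; zmod.
have fuP := aform_contract fP u; have fuQ := aform_contract fQ u.
have fuf := aform_contract ff u.
rewrite (contract_ins _ _ fP (aform_ins fQ ff))
  (contract_ins _ _ fQ (aform_ins fP ff)).
rewrite (contract_ins_fun _ fP ff) (contract_ins_fun _ fQ ff) !ins_lincomb.
rewrite (contract_ins _ _ (aform_ins_field fP fQ) ff).
rewrite (contract_ins _ _ (aform_ins_field fQ fP) ff).
rewrite (contract_ins_fun _ fP fQ) (contract_ins_fun _ fQ fP).
rewrite !(ins_lincomb_field _ _ _ _ ff).
rewrite (IHs _ _ _ _ _ _ fuP fQ ff) (IHs _ _ _ _ _ _ fP fuQ ff).
rewrite (IHs _ _ _ _ _ _ fP fQ fuf).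
rewrite !(scalerDr, scalerN) !scalerA -!signr_addb.
by case: (d); case: (e); signs; zmod.
Qed.

(** One lemma for the three identities that are needed for forms: the Jacobi
    identity of Der(h), the compatibility of the commutator with the action of
    Der(h) on h, and the fact that a derivation of h differentiates its
    bracket. *)
Lemma wedge_jacobi W1 W2 W3 (X Y X' Z : lmodType K)
    (phi1 : W1 -> X -> Z) (phi2 : W2 -> W3 -> X) (phi3 : Y -> W3 -> Z)
    (phi4 : W1 -> W2 -> Y) (phi5 : W2 -> X' -> Z) (phi6 :
      W1 -> W3 -> X') a b c f g k s :
  bilin phi1 -> bilin phi2 -> bilin phi3 -> bilin phi4 -> bilin phi5 ->
  bilin phi6 ->
  (forall x y z, phi1 x (phi2 y z) = phi3 (phi4 x y) z + phi5 y (phi6 x z)) ->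
  aform a f -> aform b g -> aform c k ->
  wedge phi1 f (wedge phi2 g k) s =
    wedge phi3 (wedge phi4 f g) k s
    + (-1) ^+ (a && b) *: wedge phi5 g (wedge phi6 f k) s.
Proof.
move=> b1 b2 b3 b4 b5 b6 jac.
elim: s a b c f g k => [|u s IHs] a b c f g k ff fg fk.
  rewrite /wedge /= jac; congr (_ + _).
  case: a ff => ff; last by rewrite scale1r.
  by rewrite (aform_parity ff) // (bilin0l b6) (bilin0r b5) scaler0.
have fuf := aform_contract ff u; have fug := aform_contract fg u.
have fuk := aform_contract fk u.
rewrite (contract_wedge _ _ b1 ff (aform_wedge b2 fg fk)).
rewrite (contract_wedge _ _ b3 (aform_wedge b4 ff fg) fk).
rewrite (contract_wedge _ _ b5 fg (aform_wedge b6 ff fk)).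
rewrite (contract_wedge_fun _ b2 fg fk) (contract_wedge_fun _ b4 ff fg).
rewrite (contract_wedge_fun _ b6 ff fk) (wedge_lincombl b3).
rewrite (wedge_lincombr b1) (wedge_lincombr b5).
rewrite (IHs _ _ _ _ _ _ fuf fg fk) (IHs _ _ _ _ _ _ ff fug fk).
rewrite (IHs _ _ _ _ _ _ ff fg fuk) !scalerDr !scalerA -!signr_addb.
by case: (a); case: (b); signs; zmod.
Qed.

Lemma wedge_anticomm W1 W2 W3 (phi : W1 -> W2 -> W3) (psi : W2 -> W1 -> W3) a b
    f g s :
  bilin phi -> bilin psi -> (forall x y, phi x y = - psi y x) ->
  aform a f -> aform b g ->
  wedge phi f g s = - ((-1) ^+ (a && b) *: wedge psi g f s).
Proof.
move=> bphi bpsi anti.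
elim: s a b f g => [|u s IHs] a b f g ff fg.
  rewrite /wedge /= anti; case: a ff => ff; last by rewrite scale1r.
  by rewrite (aform_parity ff) // (bilin0r bpsi) scaler0.
rewrite (contract_wedge _ _ bphi ff fg) (contract_wedge _ _ bpsi fg ff).
rewrite (IHs _ _ _ _ (aform_contract ff u) fg)
  (IHs _ _ _ _ ff (aform_contract fg u)).
rewrite scalerN !scalerDr !scalerA -!signr_addb.
by case: (a); case: (b); signs; zmod.
Qed.

(** The identity of h as a form of degree 1, that is, the vector field of the
    tautological coordinate; the vector field [P] is recovered as its action on
    it, see [ins_euler]. *)
Definition euler s : h := if s is [:: x] then x else 0.

Lemma aform_euler : aform true euler.
Proof.
split=> [[|y [|z s]] t c x x' /=|[|y [|z s]] t x x' /=|[|y [|z s]]] //=.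
- by case: t => //; rewrite scaler0 addr0.
- by rewrite scaler0 addr0.
- by rewrite scaler0 addr0.
- by rewrite oppr0.
- by rewrite oppr0.
- by rewrite oppr0.
Qed.

Lemma shsum_nil W (G : seq h -> W) s :
  shsum (fun S T => if T is [::] then G S else 0) s = G s.
Proof.
elim: s G => //= u s IHs G; rewrite (IHs (fun S => G (u :: S))).
by rewrite shsum_eq0 ?addr0 // => S T _; rewrite scaler0.
Qed.

Lemma ins_euler P s : ins P euler s = P s.
Proof.
by rewrite -[RHS](shsum_nil P); apply: eq_shsum => S [].
Qed.

End Operators.

(** * The bracket and the differential on words *)

Lemma selfadd_eq0 (K : fieldType) (W : lmodType K) (x : W) :
  (2 : K) != 0 -> x + x = 0 -> x = 0.
Proof.
move=> two_neq0 xx0; have /eqP : 2 *: x = 0 by rewrite scaler_nat.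
by rewrite scaler_eq0 (negbTE two_neq0) => /eqP.
Qed.

Section Bracket.
Context {K : fieldType} {h : lieAlgType K}.
Implicit Types (W : lmodType K) (s t S T : seq h).

Definition ev (D : Der h) (x : h) : h := D x.

Lemma bilin_ev : bilin ev.
Proof. by split=> // D; apply: der_linear. Qed.

Lemma bilin_lie (L : lieAlgType K) : bilin (@lie K L).
Proof. by split=> x; [apply: lie_linearl|apply: lie_linearr]. Qed.

Lemma lie_anti (L : lieAlgType K) (x y : L) : lie x y = - lie y x.
Proof.
apply/eqP; rewrite -addr_eq0; have := liexx (x + y).
by rewrite lieDl !lieDr !liexx add0r addr0 => ->.
Qed.

Lemma lie_leibniz (L : lieAlgType K) (x y z : L) :
  lie x (lie y z) = lie (lie x y) z + lie y (lie x z).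
Proof.
apply/eqP; rewrite -subr_eq0 opprD (lie_anti (lie x y) z) opprK -lieNr.
by rewrite -(lie_anti z x) addrA addrAC lie_jacobi.
Qed.

(** The vector field X_f. *)
Definition hat (f : seq h -> Der h) : seq h -> h := wedge ev f euler.

Lemma aform_hat a f : aform a f -> aform (~~ a) (hat f).
Proof.
by move=> ff; rewrite -addbT; apply: aform_wedge bilin_ev ff aform_euler.
Qed.

(** The bracket of the statement, for forms of parities [a] and [b]. *)
Definition wbracket a b (f g : seq h -> Der h) : seq h -> Der h := fun s =>
  - ins (hat g) f s + (-1) ^+ (a && b) *: ins (hat f) g s
  - (-1) ^+ (a && b) *: wedge lie f g s.

(** The Chevalley-Eilenberg vector field of h. *)
Definition mu s : h := if s is [:: x; y] then lie x y else 0.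

Definition wdiff a (f : seq h -> Der h) : seq h -> Der h := fun s =>
  (-1) ^+ a *: ins mu f s.

Lemma aform_ins_hat a b (f g : seq h -> Der h) : aform a f -> aform b g ->
  aform (a (+) b) (ins (hat f) g).
Proof. by move=> ff fg; apply: aform_ins (aform_hat ff) fg. Qed.

Lemma aform_wbracket a b f g : aform a f -> aform b g ->
  aform (a (+) b) (wbracket a b f g).
Proof.
move=> ff fg; have fgf : aform (a (+) b) (ins (hat g) f).
  by rewrite addbC; apply: aform_ins_hat.
have ffg := aform_scale ((-1) ^+ (a && b)) (aform_ins_hat ff fg).
have fw := aform_scale ((-1) ^+ (a && b)) (aform_wedge (bilin_lie _) ff fg).
exact: aform_add (aform_add (aform_opp fgf) ffg) (aform_opp fw).
Qed.

Lemma aform_mu : aform (~~ true) mu.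
Proof.
split=> [[|w [|w' s]] t c x x' /=|[|w [|w' s]] t x x' /=|[|x [|y [|z s]]] //=].
- case: t => [|w [|w' t]]; rewrite ?scaler0 ?addr0 //; exact: lie_linearl.
- case: t => [|w' t]; rewrite ?scaler0 ?addr0 //; exact: lie_linearr.
- by case: s => [|w'' s] /=; rewrite scaler0 addr0.
- by case: t => [|w t]; rewrite ?oppr0 // lie_anti.
- by rewrite oppr0.
- by case: s => [|w'' s] /=; rewrite oppr0.
Qed.

Lemma aform_wdiff a f : aform a f -> aform (~~ a) (wdiff a f).
Proof. by move=> ff; apply: aform_scale; apply: aform_ins aform_mu ff. Qed.

(** Expands the value at a bracket of any linear operator: insertions, the two
    factors of a wedge product and f |-> X_f are such operators. *)
Lemma linear_op_wbracket W (F : (seq h -> Der h) -> W) a b f g :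
  (forall c f g, F (fun s => c *: f s + g s) = c *: F f + F g) ->
  F (wbracket a b f g) =
    - F (ins (hat g) f) + (-1) ^+ (a && b) *: F (ins (hat f) g)
    - (-1) ^+ (a && b) *: F (wedge lie f g).
Proof.
move=> linF; have F0 : F (fun=> 0) = 0.
  have <- : -1 *: F (fun=> 0) + F (fun=> 0) = 0 by rewrite scaleN1r addNr.
  by rewrite -linF; congr F; apply/funext => s; rewrite scaler0 addr0.
have -> : wbracket a b f g = fun s => -1 *: ins (hat g) f s +
    ((-1) ^+ (a && b) *: ins (hat f) g s
     + (- (-1) ^+ (a && b) *: wedge lie f g s + 0)).
  by apply/funext => t; rewrite /wbracket scaleN1r addr0 scaleNr addrA.
by rewrite !linF F0 addr0 scaleN1r scaleNr addrA.
Qed.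

(** X_f acts on the two factors of [hat g], and it sends the coordinate
    [euler] to [hat f]. *)
Lemma ins_hat a b f g s : aform a f -> aform b g ->
  ins (hat f) (hat g) s =
    hat (ins (hat f) g) s + (-1) ^+ (a && b) *: wedge ev g (hat f) s.
Proof.
move=> ff fg.
rewrite /hat (ins_wedge _ bilin_ev (aform_hat ff) fg aform_euler).
by congr (_ + _ *: wedge _ _ _ _); apply/funext => t; rewrite ins_euler.
Qed.

Lemma wedge_ev_hat a b f g s : aform a f -> aform b g ->
  wedge ev f (hat g) s =
    hat (wedge lie f g) s + (-1) ^+ (a && b) *: wedge ev g (hat f) s.
Proof.
move=> ff fg; rewrite /hat.
apply: (wedge_jacobi _ bilin_ev bilin_ev bilin_ev (bilin_lie _) bilin_ev
  bilin_ev
  _ ff fg aform_euler) => D E x.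
by rewrite /ev /lie /= subrK.
Qed.

(** By [ins_comm] it suffices to compute the commutator of the vector fields
    [hat f] and [hat g]: the terms in which one coefficient differentiates the
    other give two terms of the bracket, while those in which the derivations of
    h are composed give the vector field of [wedge lie f g]. *)
Lemma ins_hat_ins_hat W a b c f g (k : seq h -> W) s :
  aform a f -> aform b g -> aform c k ->
  ins (hat f) (ins (hat g) k) s =
    (-1) ^+ (a && b) *: (ins (hat g) (ins (hat f) k) s
                         + ins (hat (wbracket a b f g)) k s).
Proof.
move=> ff fg fk.
rewrite (ins_comm _ (aform_hat ff) (aform_hat fg) fk) -addrA scalerDr.
congr (_ + _).
have lin_ins_hat : forall c f g, ins (hat (fun s => c *: f s + g s)) k s
    = c *: ins (hat f) k s + ins (hat g) k s.
  move=> e f' g'; rewrite -(ins_lincomb_field _ _ _ _ fk).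
  rewrite (_ : hat _ = fun s => e *: hat f' s + hat g' s) //.
  by apply/funext => t; exact: (wedge_lincombl bilin_ev).
rewrite (linear_op_wbracket (F := fun f => ins (hat f) k s)) //.
have -> : ins (hat f) (hat g) = fun t =>
    (-1) ^+ (a && b) *: wedge ev g (hat f) t + hat (ins (hat f) g) t.
  by apply/funext => t; rewrite (ins_hat _ ff fg) addrC.
have -> : ins (hat g) (hat f) = fun t =>
    (-1) ^+ (a && b) *: hat (wedge lie f g) t + (1 *: wedge ev g (hat f) t
     + hat (ins (hat g) f) t).
  apply/funext => t; rewrite (ins_hat _ fg ff) (wedge_ev_hat _ ff fg) [b &&
    a]andbC.
  rewrite scalerDr scalerA -signr_addb addbb; signs; zmod.
rewrite !(ins_lincomb_field _ _ _ _ fk).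
by case: (a && b); signs; rewrite ?scaleN1r ?scale1r; zmod.
Qed.

End Bracket.

(** * The differential graded Lie algebra identities on words *)

Section DGLA.
Context {K : fieldType} {h : lieAlgType K}.
Implicit Types (W : lmodType K) (s t S T : seq h).

Lemma wedge_lieC a b (f g : seq h -> Der h) s : aform a f -> aform b g ->
  wedge lie f g s = - ((-1) ^+ (a && b) *: wedge lie g f s).
Proof.
exact: (wedge_anticomm _ (bilin_lie _) (bilin_lie _) (@lie_anti _ _)).
Qed.

Lemma wbracket_antisym a b f g s : aform a f -> aform b g ->
  @wbracket K h a b f g s = - ((-1) ^+ (a && b) *: wbracket b a g f s).
Proof.
move=> ff fg; rewrite /wbracket [b && a]andbC (wedge_lieC _ ff fg).
by case: (a && b); rewrite /= ?expr0 ?expr1 ?scale1r ?scaleN1r; zmod.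
Qed.

(** The map f |-> X_f sends the bracket to the graded commutator, up to the
    sign [(-1)^(ab)] between the two conventions. *)
Lemma ins_hat_wbracket W a b c f g (k : seq h -> W) s :
  aform a f -> aform b g -> aform c k ->
  ins (hat (wbracket a b f g)) k s =
    (-1) ^+ (a && b) *: ins (hat f) (ins (hat g) k) s
    - ins (hat g) (ins (hat f) k) s.
Proof.
move=> ff fg fk; rewrite (ins_hat_ins_hat _ ff fg fk) scalerA -signr_addb addbb.
by signs; zmod.
Qed.

(** Everything is expanded into the terms X X f, X f /\ g, f /\ X g and
    f /\ g /\ k, which cancel for each choice of the three parities. *)
Lemma wbracket_jacobi a b c f g k s : aform a f -> aform b g -> aform c k ->
  @wbracket K h a (b (+) c) f (wbracket b c g k) s =
    wbracket (a (+) b) c (wbracket a b f g) k s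
    + (-1) ^+ (a && b) *: wbracket b (a (+) c) g (wbracket a c f k) s.
Proof.
move=> ff fg fk.
have linins P : forall c f g, ins P (fun s => c *: f s + g s) s
    = c *: ins P f s + ins P g s :> Der h by move=> *; apply: ins_lincomb.
have linwr f' : forall c f g, wedge lie f' (fun s => c *: f s + g s) s
    = c *: wedge lie f' f s + wedge lie f' g s :> Der h.
  by move=> *; apply: (wedge_lincombr (bilin_lie _)).
have linwl f' : forall c f g, wedge lie (fun s => c *: f s + g s) f' s
    = c *: wedge lie f f' s + wedge lie g f' s :> Der h.
  by move=> *; apply: (wedge_lincombl (bilin_lie _)).
have insB P d e f1 g1 := linear_op_wbracket (F := fun f => ins P f s) d e f1 g1
  (linins P).
have wrB P d e f1 g1 := linear_op_wbracket (F := fun f => wedge lie P f s) d e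
  f1 g1 (linwr P).
have wlB P d e f1 g1 := linear_op_wbracket (F := fun f => wedge lie f P s) d e
  f1 g1 (linwl P).
have wjac := wedge_jacobi s (bilin_lie _) (bilin_lie _) (bilin_lie _)
  (bilin_lie _) (bilin_lie _) (bilin_lie _) (@lie_leibniz _ _) ff fg fk.
have insw d e e' P g1 k1 : aform (~~ d) P -> aform e g1 -> aform e' k1 -> _ :=
  @ins_wedge _ _ _ _ _ _ d e e' P g1 k1 s (bilin_lie _).
rewrite [LHS]/wbracket [wbracket (_ (+) _) _ _ _ s]/wbracket.
rewrite [wbracket _ (_ (+) _) _ _ s]/wbracket.
rewrite (ins_hat_wbracket _ fg fk ff) (ins_hat_wbracket _ ff fg fk).
rewrite (ins_hat_wbracket _ ff fk fg).
rewrite !insB !wrB !wlB wjac.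
rewrite (insw _ _ _ _ _ _ _ (aform_hat ff) fg fk).
rewrite (insw _ _ _ _ _ _ _ (aform_hat fg) ff fk).
rewrite (insw _ _ _ _ _ _ _ (aform_hat fk) ff fg).
(* The only product that occurs in both orders. *)
rewrite (wedge_lieC s (aform_ins_hat fk ff) fg).
rewrite !(scalerDr, scalerN) !scalerA -!signr_addb.
by case: (a); case: (b); case: (c); signs; zmod.
Qed.

(** Both sides measure the action of a derivation on the bracket of h: on the
    left it acts on one argument, on the right on the value.  Since
    [2 *: mu = wedge lie euler euler], this is [wedge_jacobi] for the derivation
    property. *)
Lemma ins_mu_hat a f s : aform a f -> (2 : K) != 0 ->
  ins (hat f) mu s = wedge ev f mu s :> h.
Proof.
move=> ff two_neq0.
have lie_euler t : wedge lie euler euler t = mu t + mu t :> h.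
  case: t => [|x [|y [|z t]]].
  - by rewrite /wedge /= !lie0l addr0.
  - by rewrite /wedge /= !(lie0l, lie0r) scaler0 !addr0.
  - rewrite /wedge /= !(lie0l, lie0r, scaler0) expr0 expr1 scaleN1r scale1r.
    by rewrite -lie_anti; zmod.
  - rewrite /= addr0; apply: shsum_eq0 => -[|a1 [|a2 S]] [|b1 [|b2 T]] //=;
    by rewrite ?lie0l ?lie0r.
have insmu P t : ins P mu t = wedge lie P euler t.
  by apply: eq_shsum => S [|x [|y T]] //=; rewrite lie0r.
apply: subr0_eq; apply: (selfadd_eq0 two_neq0); rewrite insmu.
have := wedge_jacobi s bilin_ev (bilin_lie _) (bilin_lie _) bilin_ev
  (bilin_lie _) bilin_ev (@der_lie K h) ff (aform_euler (h := h)) (aform_euler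
    (h := h)).
rewrite (_ : wedge lie euler euler = fun t => 1 *: mu t + mu t); last first.
  by apply/funext => t; rewrite scale1r lie_euler.
rewrite (wedge_lincombr bilin_ev) scale1r.
rewrite (wedge_anticomm s (bilin_lie _) (bilin_lie _) (@lie_anti _ _)
  (aform_euler (h := h)) (aform_hat ff)).
rewrite -/(hat f) => mu2; rewrite addrACA -opprD mu2.
by case: (a); signs; zmod.
Qed.

(** By [ins_comm], twice the square of the insertion of [mu] is the insertion
    of [2 *: ins mu mu], which vanishes by the Jacobi identity of h. *)
Lemma wdiff_square a f s : aform a f -> (2 : K) != 0 ->
  wdiff (~~ a) (wdiff a f) s = 0 :> Der h.
Proof.
move=> ff two_neq0; rewrite /wdiff.
have -> : ins mu (fun t => (-1) ^+ a *: ins mu f t) s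
   = (-1) ^+ a *: ins mu (ins mu f) s by rewrite /ins shsumZ.
suff -> : ins mu (ins mu f) s = 0 by rewrite !scaler0.
apply: (selfadd_eq0 two_neq0).
rewrite [X in _ + X](ins_comm _ aform_mu aform_mu ff).
suff mumu : ins mu mu = fun=> 0 :> h.
  rewrite mumu [ins (fun=> 0) f s]shsum_eq0 => [|S T _]; first by signs; zmod.
  exact: (aform0 ff [::]).
apply/funext => t.
case: (eqVneq (size t) 3) => [|size_t].
  case: t => [|x [|y [|z [|]]]] //= _.
  rewrite /ins /= !(lie0l, lie0r, scaler0, addr0, add0r) /=.
  rewrite expr0 expr1 sqrrN expr1n !scale1r scaleN1r (lie_anti (lie x y)).
  rewrite (lie_anti x z) lieNl (lie_anti (lie z x)) (lie_anti (lie y z)).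
  by rewrite -[RHS]oppr0 -(lie_jacobi z x y); zmod.
apply: shsum_eq0 => -[|a1 [|a2 [|a3 S]]] [|b1 [|b2 T]] //= sT.
all: rewrite ?lie0l //.
by move: size_t; rewrite -sT.
Qed.

Lemma wbracket_lincombl a b c f f' g s : aform b g ->
  wbracket a b (fun s => c *: f s + f' s) g s =
    c *: wbracket a b f g s + wbracket a b f' g s :> Der h.
Proof.
move=> fg; rewrite /wbracket ins_lincomb (wedge_lincombl (bilin_lie _)).
have -> : hat (fun s => c *: f s + f' s) = fun s => c *: hat f s + hat f' s.
  by apply/funext => t; exact: (wedge_lincombl bilin_ev).
rewrite (ins_lincomb_field _ _ _ _ fg).
by case: (a && b); signs; rewrite !(scalerDr, scalerN); zmod.
Qed.

Lemma wbracket_lincombr a b c f g g' s : aform a f ->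
  wbracket a b f (fun s => c *: g s + g' s) s =
    c *: wbracket a b f g s + wbracket a b f g' s :> Der h.
Proof.
move=> ff; rewrite /wbracket ins_lincomb (wedge_lincombr (bilin_lie _)).
have -> : hat (fun s => c *: g s + g' s) = fun s => c *: hat g s + hat g' s.
  by apply/funext => t; exact: (wedge_lincombl bilin_ev).
rewrite (ins_lincomb_field _ _ _ _ ff).
by case: (a && b); signs; rewrite !(scalerDr, scalerN); zmod.
Qed.

Lemma wbracket_scalel a b c f g s : aform b g ->
  wbracket a b (fun s => c *: f s) g s = c *: wbracket a b f g s :> Der h.
Proof.
move=> fg.
have -> : (fun s => c *: f s) = fun s => (c - 1) *: f s + f s.
  by apply/funext => t; rewrite -[X in _ + X]scale1r -scalerDl subrK.
by rewrite wbracket_lincombl // -[X in _ + X]scale1r -scalerDl subrK.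
Qed.

Lemma wbracket_scaler a b c f g s : aform a f ->
  wbracket a b f (fun s => c *: g s) s = c *: wbracket a b f g s :> Der h.
Proof.
move=> ff.
have -> : (fun s => c *: g s) = fun s => (c - 1) *: g s + g s.
  by apply/funext => t; rewrite -[X in _ + X]scale1r -scalerDl subrK.
by rewrite wbracket_lincombr // -[X in _ + X]scale1r -scalerDl subrK.
Qed.

(** The commutator of [mu] and X_g is the vector field of the coefficient
    [ins mu g]: the remaining term, the action of [g] on [mu], cancels by
    [ins_mu_hat]. *)
Lemma ins_mu_ins_hat b c g (k : seq h -> Der h) s :
  aform b g -> aform c k -> (2 : K) != 0 ->
  ins mu (ins (hat g) k) s =
    (-1) ^+ b *: ins (hat g) (ins mu k) s + ins (hat (ins mu g)) k s.
Proof.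
move=> fg fk two_neq0; rewrite (ins_comm _ aform_mu (aform_hat fg) fk) /=.
have -> : ins mu (hat g) = fun t =>
    (-1) ^+ b *: wedge ev g mu t + hat (ins mu g) t.
  apply/funext => t; rewrite /hat.
  rewrite (ins_wedge _ bilin_ev aform_mu fg aform_euler) addrC /=.
  by rewrite (_ : ins mu euler = mu) //; apply/funext => r; rewrite ins_euler.
have -> : ins (hat g) mu = wedge ev g mu.
  by apply/funext => t; exact: ins_mu_hat fg two_neq0.
by rewrite (ins_lincomb_field _ _ _ _ fk); zmod.
Qed.

Lemma wbracket_leibniz a b f g s : aform a f -> aform b g -> (2 : K) != 0 ->
  wdiff (a (+) b) (wbracket a b f g) s =
    wbracket (~~ a) b (wdiff a f) g s
    + (-1) ^+ a *: wbracket a (~~ b) f (wdiff b g) s :> Der h.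
Proof.
move=> ff fg two_neq0; rewrite /wdiff wbracket_scalel // wbracket_scaler //
  /wbracket.
have linmu : forall c f g, ins mu (fun s => c *: f s + g s) s
    = c *: ins mu f s + ins mu g s :> Der h by move=> *; apply: ins_lincomb.
rewrite -/(wbracket a b f g) (linear_op_wbracket (F := fun f => ins mu f s)
  _ _ _ _ linmu).
rewrite (ins_mu_ins_hat _ fg ff) // (ins_mu_ins_hat _ ff fg) //.
rewrite (ins_wedge _ (bilin_lie _) aform_mu ff fg).
rewrite !(scalerDr, scalerN) !scalerA -!signr_addb.
by case: (a); case: (b); signs; zmod.
Qed.

End DGLA.

(** * Sums over shuffle permutations as sums over words *)

Lemma enum_ord_lift N (i : 'I_N.+1) :
  enum 'I_N.+1 =
    map (lift i) (take i (enum 'I_N)) ++ i :: map (lift i) (drop i (enum 'I_N)).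
Proof.
have enumE n : map (@nat_of_ord n) (enum 'I_n) = iota 0 n := val_enum_ord n.
apply: (inj_map (@ord_inj _)); rewrite map_cat enumE /= -!map_comp.
have -> : [seq (@nat_of_ord _ \o lift i) p | p <- take i (enum 'I_N)] =
  iota 0 i.
  rewrite (eq_map (g := bump i \o @nat_of_ord N)) // map_comp map_take enumE.
  rewrite take_iota (minn_idPl _) -1?ltnS // -[RHS]map_id.
  by apply/eq_in_map => p; rewrite mem_iota /= /bump add0n ltnNge => /negbTE->.
have -> : [seq (@nat_of_ord _ \o lift i) p | p <- drop i (enum 'I_N)] =
    iota i.+1 (N - i).
  rewrite (eq_map (g := bump i \o @nat_of_ord N)) // map_comp map_drop enumE.
  rewrite drop_iota add0n -[i.+1]addn1 addnC iotaDl.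
  by apply/eq_in_map => p; rewrite mem_iota /bump => /andP[->].
rewrite -[LHS]/(iota 0 N.+1).
by rewrite -[in LHS](subnKC (ltn_ord i)) subSS addSnnS iotaD /= add0n.
Qed.

Lemma lift_perm_inj N (i j : 'I_N.+1) : injective (lift_perm i j).
Proof.
move=> t t' /permP eq_t; apply/permP => k.
by apply: (@lift_inj _ j); rewrite -!(lift_perm_lift i).
Qed.

Lemma lift_perm_surj N (i j : 'I_N.+1) (s : 'S_N.+1) :
  s i = j -> exists t, s = lift_perm i j t.
Proof.
move=> si.
have [f fE] : exists f : 'I_N -> 'I_N, forall k, s (lift i k) = lift j (f k).
  apply: (@fin_all_exists _ _ (fun k k' => s (lift i k) = lift j k')) => k.
  case: (unliftP j (s (lift i k))) => [k' ->|].
    by exists k'.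
  by rewrite -si => /perm_inj/eqP; rewrite eq_sym (negbTE (neq_lift _ _)).
have f_inj : injective f.
  by move=> k k' eq_f; apply/(@lift_inj _ i)/(@perm_inj _ s); rewrite !fE eq_f.
exists (perm f_inj); apply/permP => k.
case: (unliftP i k) => [k'|] ->; last by rewrite lift_perm_id.
by rewrite lift_perm_lift fE permE.
Qed.

Lemma sum_lift_perm (W : nmodType) N (i j : 'I_N.+1) (P : pred 'S_N.+1)
    (F : 'S_N.+1 -> W) :
  \sum_(s | P s && (s i == j)) F s =
    \sum_(t | P (lift_perm i j t)) F (lift_perm i j t).
Proof.
rewrite -(big_imset F (A := [pred t | P (lift_perm i j t)])); last first.
  by move=> t t' _ _; apply: lift_perm_inj.
apply: eq_bigl => s; apply/andP/imsetP => [[Ps /eqP/lift_perm_surj[t st]]|[t]].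
  by exists t; rewrite // inE -st.
by rewrite inE => Pt ->; rewrite lift_perm_id.
Qed.

Section BlockShuffles.
Context {T : Type} {K : fieldType} {W : lmodType K}.

Definition blocks N (b : 'I_N -> nat) (v : 'I_N -> T) (l : nat) : seq T :=
  [seq v p | p <- enum 'I_N & b p == l].

Definition block_size N (b : 'I_N -> nat) l :=
  count (fun p => b p == l) (enum 'I_N).

Definition put_front (S : nat -> seq T) j u l :=
  if l == j then u :: S l else S l.

(** The analogue of [shsum] for [k] blocks, the block [l] of a splitting [S]
    being [S l].  A letter that goes to the block [j] jumps over the later
    letters of all the blocks before it. *)
Fixpoint block_shsum k (B : (nat -> seq T) -> W) (s : seq T) : W :=
  if s is u :: s' then
    \sum_(j < k) block_shsum k (fun S =>
      (-1) ^+ (\sum_(l < j) size (S l)) *: B (put_front S j u)) s'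
  else B (fun=> [::]).

(** The shuffle condition for an arbitrary assignment [b] of blocks to
    positions; this generality makes it stable under deleting a position. *)
Definition block_mono N (b : 'I_N -> nat) (sigma : 'S_N) :=
  [forall p : 'I_N, forall q : 'I_N,
     (b p == b q) && (p < q)%N ==> (sigma p < sigma q)%N].

Definition starts_block N (b : 'I_N -> nat) (i : 'I_N) :=
  [forall p : 'I_N, (p < i)%N ==> (b p != b i)].

Lemma block_shsum0 k B s : (forall S, B S = 0) -> block_shsum k B s = 0.
Proof.
elim: s B => [|u s IHs] B B0 /=; first exact: B0.
by rewrite big1 // => j _; apply: IHs => S; rewrite B0 scaler0.
Qed.

(** Deleting the position [i] of the value 0 from a shuffle leaves a shuffle,
    and [i] has to be the first position of its block. *)
Lemma block_mono_lift N (b : 'I_N.+1 -> nat) i (tau : 'S_N) :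
  block_mono b (lift_perm i ord0 tau) =
    starts_block b i && block_mono (b \o lift i) tau.
Proof.
apply/forallP/andP => [mono|[/forallP start /forallP mono] p].
  split; apply/forallP => p; last apply/forallP => q.
    apply/implyP => lt_pi; apply/negP => /eqP eq_b.
    have /forallP/(_ i) := mono p.
    by rewrite eq_b eqxx lt_pi lift_perm_id.
  apply/implyP => /andP[/= eq_b lt_pq].
  have /forallP/(_ (lift i q)) := mono (lift i p).
  rewrite !lift_perm_lift eq_b /= => /implyP; rewrite /bump; apply.
  by move: lt_pq; case: leqP; case: leqP; lia.
apply/forallP => q; apply/implyP => /andP[eq_b lt_pq].
case: (unliftP i q) eq_b lt_pq => [q'|] -> eq_b lt_pq; last first.
  by have := start p; rewrite lt_pq eq_b.
case: (unliftP i p) eq_b lt_pq => [p'|] -> eq_b lt_pq; last first.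
  by rewrite lift_perm_id lift_perm_lift.
rewrite !lift_perm_lift.
have /forallP/(_ q')/implyP lt_tau := mono p'.
have : (tau p' < tau q')%N.
  apply: lt_tau; rewrite /= eq_b /=.
  by move: lt_pq; rewrite /= /bump; case: leqP; case: leqP; lia.
by rewrite /= /bump.
Qed.

Lemma blocks_lift N (b : 'I_N.+1 -> nat) (v : 'I_N.+1 -> T) i :
  starts_block b i ->
  blocks b v = put_front (blocks (b \o lift i) (v \o lift i)) (b i) (v i).
Proof.
move=> /forallP start; apply/funext => l; rewrite /blocks /put_front.
have -> : forall S : seq T,
    (if l == b i then v i :: S else S) = (if l == b i then [:: v i] else [::])
      ++ S.
  by move=> S; case: ifP.
rewrite -[in RHS](cat_take_drop i (enum 'I_N)) (enum_ord_lift i).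
rewrite !filter_cat !map_cat /= ![filter _ (map _ _)]filter_map.
have [->|ne_l] := eqVneq l (b i); last by rewrite -!map_comp.
have take0 : [seq p <- take i (enum 'I_N) | b (lift i p) == b i] = [::].
  rewrite -(filter_pred0 (take i (enum 'I_N))).
  apply: eq_in_filter => p p_lt.
  apply/negbTE; have /implyP := start (lift i p); apply.
  suff lt_pi : (p < i)%N by rewrite /= /bump (leqNgt i p) lt_pi.
  have := map_f (@nat_of_ord N) p_lt.
  rewrite map_take [map _ _](val_enum_ord N) take_iota mem_iota add0n leq_min.
  by case/and3P.
by rewrite [filter (preim _ _) (take _ _)]take0 /= -map_comp.
Qed.

Lemma size_blocks N (b : 'I_N -> nat) (v : 'I_N -> T) l :
  size (blocks b v l) = block_size b l.
Proof. by rewrite size_map size_filter. Qed.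

Lemma sum_block_size N (b : 'I_N -> nat) j :
  (\sum_(l < j) block_size b l)%N = count (fun p => (b p < j)%N) (enum 'I_N).
Proof.
rewrite /block_size; elim: (enum 'I_N) => [|p s IHs] /=.
  by rewrite big1.
rewrite big_split IHs /=; congr addn; have [lt_j|le_j] := ltnP (b p) j.
  rewrite (bigD1 (Ordinal lt_j)) //= eqxx big1 // => l.
  by rewrite -val_eqE eq_sym /= => /negbTE->.
by rewrite big1 // => l _; rewrite gtn_eqF // (leq_trans (ltn_ord l)).
Qed.

(** For consecutive blocks the first position of a block is the number of
    letters in the blocks before it; this is the exponent of the sign of
    inserting 0 there. *)
Lemma sum_block_size_before N (b : 'I_N.+1 -> nat) i :
  (forall p q : 'I_N.+1, (p <= q)%N -> (b p <= b q)%N) -> starts_block b i ->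
  (\sum_(l < b i) block_size (b \o lift i) l)%N = i.
Proof.
move=> mono /forallP start; rewrite sum_block_size.
rewrite (eq_count (a2 := preim (@nat_of_ord N) (fun n => n < i)%N)); last first.
  move=> p /=; have [lt_pi|le_ip] := ltnP p i.
    have /implyP := start (lift i p).
    rewrite /= /bump (leqNgt i p) lt_pi add0n => /(_ lt_pi) ne_b.
    by rewrite ltn_neqAle ne_b mono //= /bump (leqNgt i p) lt_pi add0n ltnW.
  by apply/negbTE; rewrite -leqNgt mono //= /bump le_ip ltnW.
rewrite -count_map [map _ _](val_enum_ord N).
have -> : iota 0 N = iota 0 i ++ iota i (N - i).
  by have := iotaD 0 i (N - i); rewrite subnKC // -ltnS.
rewrite count_cat.
rewrite (eq_in_count (a2 := predT)) => [|n]; last by rewrite mem_iota =>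
  /andP[].
rewrite count_predT size_iota (eq_in_count (a2 := pred0))
  ?count_pred0 ?addn0 //.
by move=> n; rewrite mem_iota => /andP[le_in _]; rewrite /= ltnNge le_in.
Qed.

Lemma block_size_lift N (b : 'I_N.+1 -> nat) i l :
  block_size b l = ((b i == l) + block_size (b \o lift i) l)%N.
Proof.
rewrite /block_size -[in RHS](cat_take_drop i (enum 'I_N)) (enum_ord_lift i).
by rewrite !count_cat /= !count_map addnCA.
Qed.

(** Both sides satisfy the same recursion on the number of letters: the first
    letter of the word is carried by the position [i] of the value 0, the first
    one of some block.  The hypothesis on [B] selects the splittings with the
    prescribed block sizes, among all those that occur in [block_shsum]. *)
Lemma sum_block_shuffles k N (b : 'I_N -> nat) (u : 'I_N -> T) B :
  (forall p q : 'I_N, (p <= q)%N -> (b p <= b q)%N) ->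
  (forall p, (b p < k)%N) ->
  (forall S l, (l < k)%N -> size (S l) != block_size b l -> B S = 0) ->
  \sum_(s | block_mono b s) (-1) ^+ s *: B (blocks b (u \o s)) =
    block_shsum k B [seq u p | p <- enum 'I_N].
Proof.
elim: N b u B => [|N IHN] b u B mono b_lt B0.
  rewrite (big_pred1 1%g) => [|s]; last first.
    have -> : s = 1%g by apply/permP => -[].
    by rewrite /= eqxx; apply/forallP => -[].
  rewrite odd_perm1 expr0 scale1r enum_ord0 /=; congr B.
  by apply/funext => l; rewrite /blocks enum_ord0.
rewrite (partition_big (fun s : 'S_N.+1 => (s^-1)%g ord0) predT) //=.
have first0 i : \sum_(s | block_mono b s && ((s^-1)%g ord0 == i))
    (-1) ^+ s *: B (blocks b (u \o s)) =
  if starts_block b i then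
    block_shsum k (fun S => (-1) ^+ (\sum_(l < b i) size (S l)) *:
                    B (put_front S (b i) (u ord0)))
        [seq (u \o lift ord0) p | p <- enum 'I_N]
  else 0.
  rewrite (eq_bigl (fun s => block_mono b s && (s i == ord0))); last first.
    by move=> s; rewrite -(can_eq (permK s)) permKV eq_sym.
  rewrite sum_lift_perm; under eq_bigl do rewrite block_mono_lift.
  case: ifP => [start|_] /=; last by rewrite big_pred0.
  (* The remaining positions keep their blocks, now indexed through [lift i]. *)
  rewrite -(IHN (b \o lift i)); last 3 first.
  - by move=> p q le_pq; apply: mono; rewrite /= /bump; lia.
  - by move=> p; apply: b_lt.
  - move=> S l lt_l ne_size; rewrite (B0 _ l) ?scaler0 //.
    rewrite (block_size_lift b i) /put_front.
    by case: (eqVneq l (b i)) ne_size => [->|_] //=; rewrite add1n eqSS.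
  apply: eq_bigr => t _; rewrite (blocks_lift _ start) /= lift_perm_id.
  rewrite odd_lift_perm addbF signr_addb signr_odd -scalerA scalerA.
  under eq_bigr do rewrite size_blocks.
  rewrite sum_block_size_before // scalerA mulrC;
    congr (_ *: B (put_front _ _ _)).
  congr blocks; apply/funext => p /=; by rewrite lift_perm_lift.
under eq_bigr => i _ do rewrite first0.
rewrite -big_mkcond enum_ordSl /= -map_comp /=.
rewrite (partition_big (fun i => Ordinal (b_lt i)) predT) //=.
apply: eq_bigr => j _.
(* A block has exactly one first position if it is nonempty and none otherwise;
   in the latter case [B] vanishes, as it sees a letter in that block. *)
have [[i /andP[start /eqP bi_j]]|no_i] :=
    pselect (exists i, starts_block b i && (b i == j)).
  rewrite (big_pred1 i) => [|i']; first by rewrite bi_j.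
  rewrite /= -val_eqE /=; apply/andP/eqP => [[start' /eqP bi'_j]|->];
    last first.
    by rewrite bi_j.
  apply: val_inj => /=; have [lt_ii'|lt_i'i|//] := ltngtP i' i.
    by have /forallP/(_ i')/implyP/(_ lt_ii') := start; rewrite bi_j bi'_j eqxx.
  by have /forallP/(_ i)/implyP/(_ lt_i'i) := start'; rewrite bi_j bi'_j eqxx.
rewrite big_pred0 => [|i]; last first.
  by apply/negbTE/negP => ij; apply: no_i; exists i; rewrite -val_eqE in ij.
rewrite block_shsum0 // => S; rewrite (B0 _ j) ?scaler0 // /put_front eqxx /=.
suff -> : block_size b j = 0%N by [].
apply/eqP; rewrite -leqn0 leqNgt -has_count; apply/negP => /hasP[p0 _ bp0].
case: (@arg_minnP _ p0 (fun p => b p == j) (@nat_of_ord _) bp0) => i bi_j min_i.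
apply: no_i; exists i; rewrite bi_j andbT; apply/forallP => p;
  apply/implyP => lt_pi.
apply/negP => bp_i; have := min_i p; rewrite (eqP bp_i) bi_j leqNgt lt_pi.
by move/(_ isT).
Qed.

End BlockShuffles.

(** * Two and three blocks, and the sum over pairs *)

Section SmallShuffles.
Context {K : fieldType} {h : lmodType K} {W : lmodType K}.

Lemma block_shsum2 B (s : seq h) :
  block_shsum 2 B s = shsum (fun S T => B (nth [::] [:: S; T])) s :> W.
Proof.
elim: s B => [|u s IHs] B /=.
  by congr B; apply/funext => -[|[|[|l]]].
rewrite !big_ord_recl big_ord0 addr0 !IHs /=; congr (_ + _);
  apply: eq_shsum => S T _.
  rewrite big_ord0 scale1r; congr B; by apply/funext => -[|[|l]].
rewrite /= big_ord_recl big_ord0 addn0 /=; congr (_ *: B _).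
by apply/funext => -[|[|l]].
Qed.

Lemma block_shsum3 B (s : seq h) :
  block_shsum 3 B s =
    shsum (fun S T => shsum (fun S1 S2 => B (nth [::] [:: S1; S2; T])) S) s
      :> W.
Proof.
elim: s B => [|u s IHs] B /=.
  by congr B; apply/funext => -[|[|[|[|l]]]].
rewrite !big_ord_recl big_ord0 addr0 !IHs /= shsumD addrA; congr (_ + _ + _);
  apply: eq_shsum => S T _.
- apply: eq_shsum => S1 S2 _; rewrite big_ord0 scale1r; congr B.
  by apply/funext => -[|[|[|l]]].
- apply: eq_shsum => S1 S2 _; rewrite big_ord_recl big_ord0 addn0 /=.
  by congr (_ *: B _); apply/funext => -[|[|[|l]]].
- rewrite -shsumZ; apply: eq_shsum => S1 S2 sizeS;
  rewrite !big_ord_recl big_ord0 addn0.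
  by rewrite /= sizeS; congr (_ *: B _); apply/funext => -[|[|[|l]]].
Qed.

(** The word [s] without its letter at position [i]. *)
Definition del i (s : seq h) := take i s ++ drop i.+1 s.

Lemma shsum_first0 (G : seq h -> W) s :
  shsum (fun S T => if S is [::] then G T else 0) s = G s.
Proof.
elim: s G => //= u s IHs G; rewrite shsum0 add0r -[RHS](IHs (fun T => G (u ::
  T))).
by apply: eq_shsum => -[|x S] T _; rewrite ?scale1r ?scaler0.
Qed.

Lemma shsum_first1 (G : h -> seq h -> W) s :
  shsum (fun S T => if S is [:: x] then G x T else 0) s =
    \sum_(i < size s) (-1) ^+ i *: G s`_i (del i s).
Proof.
elim: s G => [|u s IHs] G /=; first by rewrite big_ord0.
rewrite big_ord_recl /= scale1r /del /= drop0.
rewrite (shsum_first0 (G u)); congr (_ + _).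
under eq_bigr do rewrite /bump /= exprS mulN1r scaleNr.
rewrite sumrN -(IHs (fun x T => G x (u :: T))) -shsumN;
  apply: eq_shsum => -[|x [|y S]] T _.
- by rewrite scaler0 oppr0.
- by rewrite scaleN1r.
- by rewrite scaler0 oppr0.
Qed.

(** A splitting whose first block has two letters is given by their positions
    [i < j]; moving them to the front costs [i + (j - 1)] transpositions. *)
Lemma shsum_first2 (G : h -> h -> seq h -> W) s :
  shsum (fun S T => if S is [:: x; y] then G x y T else 0) s =
    \sum_(i < size s) \sum_(j < size s | (i < j)%N)
      (-1) ^+ (i + j + 1) *: G s`_i s`_j (del i (del j s)).
Proof.
elim: s G => [|u s IHs] G /=; first by rewrite big_ord0.
rewrite big_ord_recl big_mkcond big_ord_recl /= add0r; congr (_ + _).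
  rewrite (shsum_first1 (G u)); apply: eq_bigr => j _.
  by rewrite /bump /= add0n addn1 add1n !exprS mulrA mulrNN !mul1r /del /=
    drop0.
transitivity (\sum_(i < size s) \sum_(j < size s | (i < j)%N)
      (-1) ^+ (i + j + 1) *: G s`_i s`_j (u :: del i (del j s))).
  rewrite -(IHs (fun x y T => G x y (u :: T)));
    apply: eq_shsum => -[|x [|y [|z S]]] T _;
  by rewrite ?scaler0 //= sqrrN expr1n scale1r.
apply: eq_bigr => i _; rewrite [RHS]big_mkcond big_ord_recl /= add0r.
rewrite big_mkcond; apply: eq_bigr => j _; rewrite /bump /= !add1n ltnS.
have -> : (i.+1 + j.+1 + 1 = (i + j + 1).+2)%N by lia.
by rewrite 2!exprS mulrA mulrNN !mul1r.
Qed.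

Lemma nth_del i (s : seq h) k : (del i s)`_k = s`_(bump i k).
Proof.
rewrite /del nth_cat size_take /bump; have [lt_i|le_i] := ltnP i (size s).
  have [lt_k|le_k] := ltnP k i; first by rewrite nth_take.
  by rewrite nth_drop addSn subnKC // add1n.
rewrite take_oversize // drop_oversize ?leqW // nth_nil.
case: ltnP => [lt_k|le_k]; first by rewrite leqNgt (leq_trans lt_k).
by rewrite nth_default // (leq_trans le_k) // leq_addl.
Qed.

Lemma size_del i (s : seq h) : (i < size s)%N -> size (del i s) = (size s).-1.
Proof. by move=> lt_i; rewrite size_cat size_take size_drop lt_i; lia. Qed.

End SmallShuffles.

(** * Cochains as functions on words *)

Definition word (T : Type) n (u : 'I_n -> T) : seq T :=
  [seq u i | i <- enum 'I_n].

Lemma size_word (T : Type) n (u : 'I_n -> T) : size (word u) = n.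
Proof. by rewrite size_map size_enum_ord. Qed.

Lemma nth_word (T : Type) x0 n (u : 'I_n -> T) (i : 'I_n) :
  nth x0 (word u) i = u i.
Proof. by rewrite (nth_map i) ?size_enum_ord // nth_ord_enum. Qed.

Section Words.
Context {K : fieldType} {h : lieAlgType K}.

(** The extension of a cochain to all words, by 0 on those of the wrong
    length, so that composite operations need no casts between degrees. *)
Definition wcochain n (alpha : Cbar h n) (s : seq h) : Der h :=
  if size s == n then alpha (fun i : 'I_n => s`_i) else 0.

Lemma wcochain_word n (alpha : Cbar h n) u : wcochain alpha (word u) = alpha u.
Proof.
rewrite /wcochain size_word eqxx; congr (Cbar_fun _ _); apply/funext => i.
by rewrite nth_word.
Qed.

Lemma wcochain_size n (alpha : Cbar h n) s : size s != n ->
  wcochain alpha s = 0.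
Proof. by rewrite /wcochain => /negbTE->. Qed.

Lemma word_nth n (s : seq h) : size s = n -> s = word (fun i : 'I_n => s`_i).
Proof.
move=> size_s; apply: (@eq_from_nth _ 0) => [|i lt_i];
  first by rewrite size_word.
rewrite size_s in lt_i; by rewrite (nth_word 0 _ (Ordinal lt_i)).
Qed.

Lemma wcochain_inj n (alpha beta : Cbar h n) :
  (forall s, wcochain alpha s = wcochain beta s) -> alpha = beta.
Proof.
by move=> eq_ab; apply/val_inj/funext => u; rewrite /= -!wcochain_word eq_ab.
Qed.

Lemma word_eta n (s t : seq h) x (lt_s : (size s < n)%N) :
  (fun i : 'I_n => (s ++ x :: t)`_i) =
    [eta (fun i : 'I_n => (s ++ 0 :: t)`_i) with Ordinal lt_s |-> x].
Proof.
apply/funext => i /=; rewrite -val_eqE /= !nth_cat.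
case: ltngtP => // [lt_si|->]; last by rewrite subnn.
by rewrite -(subnSK lt_si).
Qed.

Lemma aform_wcochain n (alpha : Cbar h n) : aform (odd n) (wcochain alpha).
Proof.
have /asboolP[lin alt] := Cbar_funP alpha.
have linS s t : linear (fun x => wcochain alpha (s ++ x :: t)).
  move=> c x y; rewrite /wcochain !size_cat /=.
  case: eqP => [size_st|_]; last by rewrite scaler0 addr0.
  have lt_s : (size s < n)%N by rewrite -size_st addnS ltnS leq_addr.
  by rewrite (word_eta _ (c *: x + y) lt_s) lin -!word_eta.
split=> // [s t x y|s ne_s]; last first.
  by apply: wcochain_size; apply: contra ne_s => /eqP->.
have alt0 z : wcochain alpha (s ++ z :: z :: t) = 0.
  rewrite /wcochain size_cat /=; case: eqP => // size_st.
  have lt_s : (size s < n)%N by rewrite -size_st addnS ltnS leq_addr.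
  have lt_Ss : ((size s).+1 < n)%N by rewrite -size_st !addnS !ltnS leq_addr.
  apply: (alt _ (Ordinal lt_s) (Ordinal lt_Ss)).
    by rewrite -val_eqE /= neq_ltn ltnSn.
  by rewrite /= !nth_cat ltnn subnn ltnNge leqnSn /= subSnn.
have addS s' t' z w : wcochain alpha (s' ++ (z + w) :: t') =
    wcochain alpha (s' ++ z :: t') + wcochain alpha (s' ++ w :: t').
  by have := linS s' t' 1 z w; rewrite !scale1r.
apply/eqP; rewrite -addr_eq0; apply/eqP.
rewrite -[RHS](alt0 (x + y)) addS.
have := addS (s ++ [:: x]) t x y; rewrite -!catA /= => ->.
have := addS (s ++ [:: y]) t x y; rewrite -!catA /= => ->.
by rewrite !alt0 add0r addr0.
Qed.

Lemma skew_move a (f : seq h -> Der h) s t r x : aform a f ->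
  f (s ++ x :: t ++ r) = (-1) ^+ size t *: f (s ++ t ++ x :: r).
Proof.
move=> ff; elim: t s => [|y t IHt] s /=; first by rewrite scale1r.
rewrite (aform_skew ff) -cat_rcons IHt cat_rcons exprS mulN1r scaleNr //.
Qed.

(** Conversely a form on words is alternating when two arbitrary, not only two
    adjacent, arguments agree: by [skew_move] they can be made adjacent, and
    then skew-symmetry yields twice the value. *)
Lemma aform_cochain a (f : seq h -> Der h) n : (2 : K) != 0 ->
  aform a f -> (fun u : 'I_n -> h => f (word u)) \in cochain (h := h) (n := n).
Proof.
move=> two_neq0 ff; apply/asboolP; split=> [u i c x y|u i j ne_ij eq_ij].
  have wordE z : word [eta u with i |-> z] =
      take i (word u) ++ z :: drop i.+1 (word u).
    apply: (@eq_from_nth _ 0) => [|k].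
      by rewrite size_cat /= size_take size_drop !size_word ltn_ord;
        have := ltn_ord i; lia.
    rewrite size_word => lt_k; rewrite (nth_word 0 _ (Ordinal lt_k)) /=.
    rewrite nth_cat size_take size_word ltn_ord -val_eqE /=.
    case: ltngtP => [lt_ki|lt_ik|->]; last by rewrite subnn.
      by rewrite nth_take // (nth_word 0 u (Ordinal lt_k)).
    rewrite -(subnSK lt_ik) /= nth_drop subnKC //.
    by rewrite (nth_word 0 u (Ordinal lt_k)).
  by rewrite !wordE (aform_linear ff).
wlog lt_ij : i j ne_ij eq_ij / (i < j)%N.
  move=> wl; have [lt_ij|lt_ji|/val_inj eq] := ltngtP i j.
  - exact: wl lt_ij.
  - by apply: wl lt_ji; rewrite // eq_sym.
  - by rewrite eq eqxx in ne_ij.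
have [s [t [r ->]]] : exists s t r, word u = s ++ u i :: t ++ u i :: r.
  exists (take i (word u)), (take (j - i.+1) (drop i.+1 (word u))).
  exists (drop j.+1 (word u)).
  rewrite -[LHS](cat_take_drop i) (drop_nth 0) ?size_word // nth_word.
  rewrite -[drop i.+1 _ in LHS](cat_take_drop (j - i.+1)) drop_drop subnK //.
  by rewrite (drop_nth 0 (n := j)) ?size_word // nth_word eq_ij.
rewrite (skew_move _ _ _ _ ff).
suff -> : f (s ++ t ++ u i :: u i :: r) = 0 by rewrite scaler0.
apply: (selfadd_eq0 two_neq0); rewrite catA.
by rewrite {1}(aform_skew ff) addNr.
Qed.
End Words.

(** * The explicit formulas in terms of words *)

Lemma enum_ordD n m :
  enum 'I_(n + m) = map (lshift m) (enum 'I_n) ++ map (@rshift n m) (enum 'I_m).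
Proof.
have enumE k : map (@nat_of_ord k) (enum 'I_k) = iota 0 k := val_enum_ord k.
apply: (inj_map (@ord_inj _)); rewrite map_cat enumE iotaD add0n.
rewrite -(map_comp _ (lshift m)) -(map_comp _ (@rshift n m)); congr (_ ++ _).
  by rewrite -[LHS]enumE; apply: eq_map.
by rewrite -[n in LHS]addn0 iotaDl -enumE -map_comp; apply: eq_map.
Qed.

Lemma reshape_index2 n m p :
  (p < n + m)%N -> reshape_index [:: n; m] p = (n <= p)%N.
Proof.
move=> lt_p; rewrite /reshape_index /=; case: leqP => [le_np|lt_pn].
  have -> : (p.+1 - n = (p - n).+1)%N by lia.
  by have -> : ((p - n).+1 - m = 0)%N by lia.
by have -> : (p.+1 - n = 0)%N by lia.
Qed.

Lemma reshape_index3 m n p : (p < m + n.+1)%N ->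
  reshape_index [:: m; 1; n] p = ((m <= p) + (m < p))%N.
Proof.
move=> lt_p; rewrite /reshape_index /=.
have [lt_mp|lt_pm|->] := ltngtP m p.
- have -> : (p.+1 - m = (p - m.+1).+2)%N by lia.
  have -> : ((p - m.+1).+2 - 1 = (p - m.+1).+1)%N by lia.
  by have -> : ((p - m.+1).+1 - n = 0)%N by lia.
- by have -> : (p.+1 - m = 0)%N by lia.
- by rewrite subSnn.
Qed.

Lemma word_cast (T : Type) n m (e : n = m) (u : 'I_m -> T) :
  word (u \o cast_ord e) = word u.
Proof. by case: m / e u => u; apply: eq_map => i; rewrite /= cast_ord_id. Qed.

Lemma blocks_ordD (T : Type) n m (b : 'I_(n + m) -> nat)
    (v : 'I_(n + m) -> T) l :
  blocks b v l = blocks (b \o lshift m) (v \o lshift m) l ++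
    blocks (b \o @rshift n m) (v \o @rshift n m) l.
Proof.
by rewrite /blocks enum_ordD filter_cat map_cat !filter_map -!map_comp.
Qed.

Lemma blocks_ordS (T : Type) n (b : 'I_n.+1 -> nat) (v : 'I_n.+1 -> T) l :
  blocks b v l = (if b ord0 == l then [:: v ord0] else [::]) ++
    blocks (b \o lift ord0) (v \o lift ord0) l.
Proof.
rewrite /blocks enum_ordSl /= filter_map.
by case: ifP => _ /=; rewrite -map_comp.
Qed.

Lemma blocks_const (T : Type) n c (b : 'I_n -> nat) (v : 'I_n -> T) l :
  (forall p, b p = c) -> blocks b v l = if c == l then word v else [::].
Proof.
move=> bc; rewrite /blocks (eq_filter (a2 := fun=> c == l)) => [|p]; last first.
  by rewrite bc.
by case: eqP => _; rewrite ?filter_predT ?filter_pred0.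
Qed.

Section Formulas.
Context {K : fieldType} {h : lieAlgType K}.

Lemma mem_shuffles N (s : seq int) (sigma : 'S_N) :
  all (fun i => 0 <= i) s ->
  (sigma \in shuffles N s) =
    block_mono (fun p => reshape_index (map absz s) p) sigma.
Proof. by move=> s_ge0; rewrite inE s_ge0. Qed.

Lemma wedge_shuffles n m (alpha : Cbar h n) (beta : Cbar h m) u :
  \sum_(sigma in shuffles (n + m) [:: n%:Z; m%:Z])
     (-1) ^+ sigma *:
       lie (alpha (fun k : 'I_n => u (sigma (lshift m k))))
           (beta (fun l : 'I_m => u (sigma (rshift n l)))) =
  wedge lie (wcochain alpha) (wcochain beta) (word u).
Proof.
pose b (p : 'I_(n + m)) : nat := (n <= p)%N.
have blocksE (v : _ -> h) (l : nat) : blocks b v l =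
    (if 0%N == l then word (fun k => v (lshift m k)) else [::]) ++
    (if 1%N == l then word (fun k => v (rshift n k)) else [::]).
  rewrite blocks_ordD (@blocks_const _ _ 0%N) => [|p]; last first.
    by rewrite /b /= leqNgt ltn_ord.
  by rewrite (@blocks_const _ _ 1%N) => [|p] //; rewrite /b /= leq_addr.
have block0 (v : _ -> h) : blocks b v 0%N = word (fun k => v (lshift m k)).
  by rewrite blocksE /= cats0.
have block1 (v : _ -> h) : blocks b v 1%N = word (fun k => v (rshift n k)).
  by rewrite blocksE.
pose B (S : nat -> seq h) :=
  lie (wcochain alpha (S 0%N)) (wcochain beta (S 1%N)).
transitivity (\sum_(s | block_mono b s) (-1) ^+ s *: B (blocks b (u \o s))).
  apply: eq_big => [s|s _].
    rewrite mem_shuffles //; congr block_mono; apply/funext => p.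
    exact: reshape_index2.
  by rewrite /B block0 block1 !wcochain_word.
rewrite (sum_block_shuffles (k := 2)).
- by rewrite block_shsum2.
- by move=> p q le_pq; rewrite /b; lia.
- by move=> p; rewrite /b; case: (n <= p)%N.
move=> S [|[|//]] _; rewrite -(size_blocks b (fun=> 0 : h)) ?block0 ?block1.
  by rewrite size_word => ?; rewrite /B wcochain_size ?lie0l.
by rewrite size_word => ?; rewrite /B (wcochain_size beta) ?lie0r.
Qed.

(** The three blocks become a nested sum over two blocks, and the inner one,
    by linearity in the first slot, is the value of [hat] at the first
    block. *)
Lemma insertion_sumE n m (alpha : Cbar h n) (beta : Cbar h m) u :
  insertion_sum alpha beta u =
    ins (hat (wcochain beta)) (wcochain alpha) (word u).
Proof.
(* For [n = 0] the last block has size -1: there is no shuffle, and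
   [alpha] vanishes on nonempty words. *)
case: n alpha u => [|n] alpha u.
  rewrite /insertion_sum big_pred0 => [|s]; last by rewrite inE /=.
  by rewrite [RHS]shsum_eq0 // => S T _; rewrite wcochain_size.
pose b (p : 'I_(m + n.+1)) : nat := ((m <= p) + (m < p))%N.
have blocksE (v : _ -> h) (l : nat) : blocks b v l =
    (if 0%N == l then word (fun k => v (lshift n.+1 k)) else [::]) ++
    (if 1%N == l then [:: v (rshift m ord0)] else [::]) ++
    (if 2%N == l then word (fun k => v (rshift m (lift ord0 k))) else [::]).
  rewrite blocks_ordD (@blocks_const _ _ 0%N) => [|p]; last first.
    by have := ltn_ord p; rewrite /b /=; lia.
  rewrite blocks_ordS /= (@blocks_const _ _ 2%N) => [|p]; last first.
    by rewrite /b /= /bump; lia.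
  by rewrite /b /= addn0 leqnn ltnn.
have block0 (v : _ -> h) : blocks b v 0%N = word (fun k => v (lshift n.+1 k)).
  by rewrite blocksE /= cats0.
have block1 (v : _ -> h) : blocks b v 1%N = [:: v (rshift m ord0)].
  by rewrite blocksE.
have block2 (v : _ -> h) :
    blocks b v 2%N = word (fun k => v (rshift m (lift ord0 k))).
  by rewrite blocksE.
pose B (S : nat -> seq h) :=
  wcochain alpha (ev (wcochain beta (S 0%N)) (euler (S 1%N)) :: S 2%N).
have alpha0 t : wcochain alpha (0 :: t) = 0.
  exact: (aform0 (aform_wcochain alpha) [::]).
transitivity (\sum_(s | block_mono b s) (-1) ^+ s *: B (blocks b (u \o s))).
  apply: eq_big => [s|s _].
    have predE : n.+1%:Z - 1 = n by lia.
    rewrite predE mem_shuffles //; congr block_mono; apply/funext => p.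
    exact: reshape_index3.
  rewrite /B block0 block1 block2 !wcochain_word /=.
  congr (_ *: _); rewrite -[LHS]wcochain_word; congr (wcochain alpha _).
  by rewrite /word enum_ordSl /= -map_comp.
rewrite (sum_block_shuffles (k := 3)).
- rewrite block_shsum3; apply: eq_shsum => S T _.
  rewrite /hat /wedge.
  rewrite [in RHS](linear_shsum (f := fun x => wcochain alpha (x :: T))) //.
  exact: (aform_linear (aform_wcochain alpha) [::]).
- by move=> p q le_pq; rewrite /b; lia.
- by move=> p; rewrite /b; case: (m <= p)%N; case: (m < p)%N.
move=> S [|[|[|//]]] _; rewrite -(size_blocks b (fun=> 0 : h))
  ?block0 ?block1 ?block2 ?size_word => neS.
- by rewrite /B (wcochain_size beta neS) (bilin0l bilin_ev) alpha0.
- by rewrite /B; case: (S 1%N) neS => [|x [|y t]] //= _;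
    rewrite (bilin0r bilin_ev) alpha0.
- by rewrite /B wcochain_size.
Qed.

Lemma bracket_formulaE n m (alpha : Cbar h n) (beta : Cbar h m) u :
  Cbar_bracket_formula alpha beta u =
    wbracket (odd n) (odd m) (wcochain alpha) (wcochain beta) (word u).
Proof.
rewrite /Cbar_bracket_formula !insertion_sumE wedge_shuffles /wbracket.
by rewrite word_cast -[(-1) ^+ (m * n)]signr_odd oddM andbC.
Qed.

Lemma diff_formulaE n (alpha : Cbar h n) u :
  Cbar_diff_formula alpha u = wdiff (odd n) (wcochain alpha) (word u).
Proof.
rewrite /wdiff /ins; set B := (X in shsum X _).
rewrite (@eq_shsum _ _ _ _ (fun S T =>
  if S is [:: x; y] then wcochain alpha (lie x y :: T) else 0)).
  rewrite (shsum_first2 (fun x y T => wcochain alpha (lie x y :: T))) size_word.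
  rewrite scaler_sumr; apply: eq_bigr => i _.
  rewrite scaler_sumr; apply: eq_bigr => j lt_ij.
  rewrite scalerA signr_odd -exprD !addnA; congr (_ *: _).
  have lt_j := ltn_ord j; have lt_i : (i < n)%N by lia.
  have size_j : size (del j (word u)) = n by rewrite size_del size_word.
  have size_ij : size (del i (del j (word u))) =
    n.-1 by rewrite size_del size_j.
  rewrite /wcochain /= size_ij prednK ?eqxx ?(leq_ltn_trans _ lt_i) //.
  congr (Cbar_fun _ _); apply/funext => k; rewrite !nth_word.
  case: k => -[|k] lt_k //=; rewrite !nth_del.
  have lt_bump : (bump j (bump i k) < n.+1)%N by rewrite /bump; lia.
  by rewrite -[X in _ = (word u)`_X](inordK lt_bump) nth_word.
move=> S T _; rewrite /B /mu.
have alpha0 t : wcochain alpha (0 :: t) = 0.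
  exact: (aform0 (aform_wcochain alpha) [::]).
by case: S => [|x [|y [|z S]]].
Qed.

End Formulas.

(** * The differential graded Lie algebra and its Maurer-Cartan elements *)

Section Support.
Context {K : fieldType} {h : lmodType K}.
Implicit Types W : lmodType K.

Definition homog W n (f : seq h -> W) := forall s, size s != n -> f s = 0.

Lemma homog_wedge W1 W2 W3 (phi : W1 -> W2 -> W3) n m f g : bilin phi ->
  homog n f -> homog m g -> homog (n + m) (wedge phi f g).
Proof.
move=> bphi hf hg s size_s; apply: shsum_eq0 => S T sizeST.
have [sizeS|/hf->] := eqVneq (size S) n; last exact: bilin0l.
rewrite hg ?(bilin0r bphi) //; apply: contra size_s => /eqP sizeT.
by rewrite -sizeST sizeS sizeT.
Qed.

Lemma homog_ins W a n m P (f : seq h -> W) : aform a f ->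
  homog m.+1 P -> homog n f -> homog (n + m) (ins P f).
Proof.
move=> ff hP hf s size_s; apply: shsum_eq0 => S T sizeST.
have [sizeS|/hP->] := eqVneq (size S) m.+1; last exact: (aform0 ff [::]).
rewrite hf //; apply: contra size_s => /= /eqP sizeT.
by rewrite -sizeST sizeS -sizeT !addSn addnC.
Qed.

Lemma homog_euler : homog 1 (@euler K h).
Proof. by case=> [|x [|y s]]. Qed.
End Support.

Section CbarDGLA.
Context {K : fieldType} {h : lieAlgType K} (two_neq0 : (2 : K) != 0).

Definition cbar_br n m (alpha : Cbar h n) (beta : Cbar h m) : Cbar h (n + m) :=
  MkCbar (aform_cochain (n + m) two_neq0
    (aform_wbracket (aform_wcochain alpha) (aform_wcochain beta))).

Definition cbar_diff n (alpha : Cbar h n) : Cbar h n.+1 :=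
  MkCbar (aform_cochain (n.+1) two_neq0 (aform_wdiff (aform_wcochain alpha))).

Lemma homog_wcochain n (alpha : Cbar h n) : homog n (wcochain alpha).
Proof. by move=> s; apply: wcochain_size. Qed.

Lemma homog_hat n (f : seq h -> Der h) : homog n f -> homog n.+1 (hat f).
Proof.
by move=> hf; rewrite -addn1; apply: homog_wedge bilin_ev hf homog_euler.
Qed.

Lemma homog_mu : homog 2 (@mu K h).
Proof. by case=> [|x [|y [|z s]]]. Qed.

Lemma wcochain_br n m (alpha : Cbar h n) (beta : Cbar h m) :
  wcochain (cbar_br alpha beta) =
    wbracket (odd n) (odd m) (wcochain alpha) (wcochain beta).
Proof.
apply/funext => s; have [size_s|size_s] := eqVneq (size s) (n + m)%N.
  by rewrite (word_nth size_s) wcochain_word.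
have ha := homog_wcochain alpha; have hb := homog_wcochain beta.
rewrite wcochain_size // /wbracket.
rewrite (homog_ins (aform_wcochain alpha) (homog_hat hb) ha size_s).
rewrite (homog_wedge (bilin_lie _) ha hb size_s).
rewrite addnC in size_s.
rewrite (homog_ins (aform_wcochain beta) (homog_hat ha) hb size_s).
by rewrite !scaler0 !oppr0 !addr0.
Qed.

Lemma wcochain_diff n (alpha : Cbar h n) :
  wcochain (cbar_diff alpha) = wdiff (odd n) (wcochain alpha).
Proof.
apply/funext => s; have [size_s|size_s] := eqVneq (size s) n.+1.
  by rewrite (word_nth size_s) wcochain_word.
rewrite wcochain_size // /wdiff; rewrite -addn1 in size_s.
by rewrite (homog_ins (aform_wcochain alpha) homog_mu (homog_wcochain alpha)
  size_s) scaler0.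
Qed.

Lemma wcochain_lincomb n c (alpha beta : Cbar h n) :
  wcochain (c *: alpha + beta) =
    fun s => c *: wcochain alpha s + wcochain beta s.
Proof.
by apply/funext => s; rewrite /wcochain; case: eqP; rewrite ?scaler0 ?addr0.
Qed.

Lemma wcochain_degcast m n (e : m = n) (alpha : Cbar h m) :
  wcochain (degcast (fun n => Cbar h n : lmodType K) e alpha) = wcochain alpha.
Proof. by case: n / e. Qed.

Lemma wcochain_scale n c (alpha : Cbar h n) s :
  wcochain (c *: alpha) s = c *: wcochain alpha s.
Proof. by rewrite /wcochain; case: eqP; rewrite ?scaler0. Qed.

Lemma wcochain_add n (alpha beta : Cbar h n) s :
  wcochain (alpha + beta) s = wcochain alpha s + wcochain beta s.
Proof. by rewrite /wcochain; case: eqP; rewrite ?addr0. Qed.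

Lemma wcochain_opp n (alpha : Cbar h n) s :
  wcochain (- alpha) s = - wcochain alpha s.
Proof. by rewrite /wcochain; case: eqP; rewrite ?oppr0. Qed.

Lemma wcochain_zero n s : wcochain (0 : Cbar h n) s = 0.
Proof. by rewrite /wcochain; case: eqP. Qed.

Lemma cbar_dgla : @isDGLieAlgebra K (fun n => Cbar h n) cbar_br cbar_diff.
Proof.
have sgnM n m : (-1) ^+ (n * m) = (-1) ^+ (odd n && odd m) :> K.
  by rewrite -signr_odd oddM.
split.
- move=> n m y c x x'; apply: wcochain_inj => s.
  rewrite wcochain_br !wcochain_lincomb !wcochain_br.
  exact: wbracket_lincombl (aform_wcochain y).
- move=> n m x c y y'; apply: wcochain_inj => s.
  rewrite wcochain_br !wcochain_lincomb !wcochain_br.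
  exact: wbracket_lincombr (aform_wcochain x).
- move=> n c x y; apply: wcochain_inj => s.
  rewrite wcochain_diff !wcochain_lincomb !wcochain_diff /wdiff ins_lincomb.
  by rewrite scalerDr !scalerA mulrC.
- move=> n m x y; apply: wcochain_inj => s.
  rewrite scaleNr wcochain_opp wcochain_scale wcochain_degcast !wcochain_br
    sgnM.
  exact: wbracket_antisym (aform_wcochain x) (aform_wcochain y).
- move=> n m p x y z; apply: wcochain_inj => s.
  rewrite wcochain_add wcochain_scale !wcochain_degcast !wcochain_br sgnM !oddD.
  exact: wbracket_jacobi (aform_wcochain x) (aform_wcochain y) (aform_wcochain
    z).
- move=> n x; apply: wcochain_inj => s.
  rewrite !wcochain_diff wcochain_zero /=.
  exact: wdiff_square (aform_wcochain x) two_neq0.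
- move=> n m x y; apply: wcochain_inj => s.
  (* The degrees [n.+1 + m] and [(n + m).+1] are only convertible, so this
     instance of [wcochain_br] needs its type stated. *)
  have dxy : wcochain (cbar_br (cbar_diff x) y : Cbar h (n + m).+1) s =
      wbracket (~~ odd n) (odd m) (wdiff (odd n) (wcochain x)) (wcochain y) s.
    have := congr1 (fun f => f s) (wcochain_br (cbar_diff x) y).
    by rewrite wcochain_diff.
  rewrite wcochain_add wcochain_scale wcochain_degcast wcochain_diff dxy
    !wcochain_br wcochain_diff oddD /=.
  rewrite -[(-1) ^+ n]signr_odd.
  exact: wbracket_leibniz (aform_wcochain x) (aform_wcochain y) two_neq0.
Qed.

Section MaurerCartan.
Context (L : {linear h -> Der h}).

Lemma wcochain_Cbar1 s : wcochain (Cbar1 L) s = if s is [:: x] then L x else 0.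
Proof. by case: s => [|x [|y s]]. Qed.

(** The two insertion terms of the bracket coincide, as do the two wedge terms,
    so the factor 1/2 disappears. *)
Lemma maurer_cartan_eval x y :
  wcochain (cbar_diff (Cbar1 L) + 2^-1 *: cbar_br (Cbar1 L) (Cbar1 L))
      [:: x; y] =
    lie (L x) (L y) - L (L x y) + L (L y x) - L (lie x y).
Proof.
have br11 : wcochain (cbar_br (Cbar1 L) (Cbar1 L) : Cbar h 2) =
    wbracket true true (wcochain (Cbar1 L)) (wcochain (Cbar1 L)).
  exact: (wcochain_br (Cbar1 L) (Cbar1 L)).
rewrite wcochain_add wcochain_scale wcochain_diff br11 /wdiff /wbracket /ins
  /hat /wedge /=.
have zero0 : (0 : h -> h) 0 = 0 by [].
rewrite !wcochain_Cbar1 /= zero0 /ev.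
rewrite !(scaler0, oppr0, expr0, expr1, scale1r, scaleN1r, addr0, add0r,
  lie0l, opprK).
rewrite -(lie_anti (L x)) [L (L x y - _)](linearB L) /=.
set A := L (L x y); set B := L (L y x); set C := lie (L x) (L y).
have -> : - (A - B) - (A - B) + (C + C) = (C - A + B) + (C - A + B) by zmod.
have half (v : Der h) : 2^-1 *: (v + v) = v.
  by rewrite -mulr2n -scaler_nat scalerA mulVf // scale1r.
by rewrite half; zmod.
Qed.

Lemma postlie_maurer_cartan :
  isPostLie (fun x y : h => L x y) <->
  @isMaurerCartan K (fun n => Cbar h n) cbar_br cbar_diff (Cbar1 L).
Proof.
have subE (D E : Der h) z : (D - E) z = D z - E z by [].
have addE (D E : Der h) z : (D + E) z = D z + E z by [].
have lieE (D E : Der h) z : lie D E z = D (E z) - E (D z) by [].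
have zeroE z : (0 : Der h) z = 0 by [].
split=> [[_ _ _ assoc]|mc].
  apply: wcochain_inj => s; rewrite wcochain_zero.
  have [|size_s] := eqVneq (size s) 2%N; last exact: wcochain_size.
  case: s => [|x [|y [|]]] // _; rewrite maurer_cartan_eval; apply: derP => z.
  by rewrite subE addE subE assoc /associator lieE zeroE; zmod.
split=> [y a x x'|x|x y z|x y z].
- by rewrite linearP.
- exact: der_linear.
- exact: der_lie.
- have := congr1 (fun t => wcochain t [:: x; y] z) mc.
  rewrite maurer_cartan_eval subE addE subE lieE wcochain_zero zeroE.
  move=> /(congr1 (fun w => w + L (lie x y) z)); rewrite subrK add0r => <-.
  by rewrite /associator; zmod.
Qed.

End MaurerCartan.
End CbarDGLA.

Theorem corollary3p7 (K : fieldType) (charK0 : [pchar K] =i pred0)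
    (h : lieAlgType K) :
  exists (br : forall n m, Cbar h n -> Cbar h m -> Cbar h (n + m)%N)
         (d : forall n, Cbar h n -> Cbar h n.+1),
    [/\ forall n m (alpha : Cbar h n) (beta : Cbar h m) (u : 'I_(n + m) -> h),
          br n m alpha beta u = Cbar_bracket_formula alpha beta u,
        forall n (alpha : Cbar h n) (u : 'I_n.+1 -> h),
          d n alpha u = Cbar_diff_formula alpha u,
        @isDGLieAlgebra K (fun n => Cbar h n) br d
      & forall L : {linear h -> Der h},
          isPostLie (fun x y : h => L x y) <->
          @isMaurerCartan K (fun n => Cbar h n) br d (Cbar1 L)].
Proof.
have two_neq0 : (2 : K) != 0.
  by have := charK0 2%N; rewrite !inE /= => ->.
exists (cbar_br two_neq0), (cbar_diff two_neq0);
  split=> [n m alpha beta u|n alpha u||L].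
- by rewrite bracket_formulaE.
- by rewrite diff_formulaE.
- exact: cbar_dgla.
- exact: postlie_maurer_cartan.
Qed.
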